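(* Let $R$ be a ring and let $(P,Q,\psi)$ be an $R$-system satisfying Condition (FS) whose Cuntz–Pimsner ring $\mathcal{O}_{(P,Q,\psi)}=\bigoplus_{i\in\mathbb{Z}}\mathcal{O}_i$ is well-defined. If $\mathcal{O}_{(P,Q,\psi)}$ is nearly epsilon-strongly $\mathbb{Z}$-graded and $\mathrm{Ann}_{\mathcal{O}_0}(\mathcal{O}_1)\cap(\mathrm{Ann}_{\mathcal{O}_0}(\mathcal{O}_1))^\perp=\{0\}$, then $\mathcal{O}_{(P,Q,\psi)}\cong_{\mathrm{gr}}\mathcal{O}_{(P',Q',\psi')}$ for some ring $R'$ and some $R'$-system $(P',Q',\psi')$ satisfying Condition (FS) whose Cuntz–Pimsner ring is well-defined and such that: (a) $(P',Q',\psi')$ is an s-unital $R'$-system; (b) the Cuntz–Pimsner representation $(\iota^{CP}_{P'},\iota^{CP}_{Q'},\iota^{CP}_{R'},\mathcal{O}_{(P',Q',\psi')})$ is semi-full; (c) $(P',Q',\psi')$ satisfies Condition (FS); (d) the ideal $I^{(k)}_{\psi',\iota^{CP}_{R'}}$ is s-unital for every $k\ge 0$. Conversely, if $(P',Q',\psi')$ is an $R'$-system satisfying Condition (FS) whose Cuntz–Pimsner ring is well-defined and (a)–(d) hold, then $\mathcal{O}_{(P',Q',\psi')}$ is nearly epsilon-strongly $\mathbb{Z}$-graded.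
   Context: Rings are associative but not necessarily unital. A $\mathbb{Z}$-graded ring is $S=\bigoplus_{i\in\mathbb{Z}}S_i$ with additive subgroups $S_i$ satisfying $S_mS_n\subseteq S_{m+n}$; for additive subsets $X,Y$, $XY$ denotes the additive subgroup generated by all products $xy$. A graded ring homomorphism maps each $S_i$ into $T_i$; $\cong_{\mathrm{gr}}$ denotes graded ring isomorphism. For rings $A,B$, an $A$-$B$-bimodule $M$ is s-unital if for every $x\in M$ there are $a\in A$, $b\in B$ with $ax=x=xb$, and unital if there are $a\in A$, $b\in B$ with $ax=x=xb$ for all $x\in M$. A ring $R$ is s-unital if it is s-unital as an $R$-$R$-bimodule; an ideal is called s-unital (resp. unital) if, regarded as a ring, it is s-unital (resp. has a multiplicative identity). A $\mathbb{Z}$-graded ring $S$ is nearly epsilon-strongly graded if each $S_i$ is an s-unital $S_iS_{-i}$-$S_{-i}S_i$-bimodule. For a $\mathbb{Z}$-graded ring $A$, $\mathrm{Ann}_{A_0}(A_1)=\{r\in A_0: ra=0\ \forall a\in A_1\}$, and for an ideal $J$ of $A_0$, $J^\perp=\{r\in A_0: rx=xr=0\ \forall x\in J\}$. An $R$-system is a triple $(P,Q,\psi)$ with $P,Q$ $R$-bimodules and $\psi:P\otimes_RQ\to R$ an $R$-bimodule homomorphism. It is s-unital if $R$ is an s-unital ring and $P,Q$ are s-unital $R$-$R$-bimodules. Put $P^{\otimes0}=Q^{\otimes0}=R$, $\psi_0(r\otimes r')=rr'$, $\psi_1=\psi$, and for $n>1$: $Q^{\otimes n}=Q^{\otimes(n-1)}\otimes_RQ$,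 $P^{\otimes n}=P\otimes_RP^{\otimes(n-1)}$, $\psi_n((p_1\otimes p_2)\otimes(q_2\otimes q_1))=\psi(p_1\psi_{n-1}(p_2\otimes q_2)\otimes q_1)$ for $p_1\in P,p_2\in P^{\otimes(n-1)},q_2\in Q^{\otimes(n-1)},q_1\in Q$. A covariant representation of $(P,Q,\psi)$ is a tuple $(S,T,\sigma,B)$ with $B$ a ring, $S:P\to B$, $T:Q\to B$ additive maps, $\sigma:R\to B$ a ring homomorphism, such that $S(pr)=S(p)\sigma(r)$, $S(rp)=\sigma(r)S(p)$, $T(qr)=T(q)\sigma(r)$, $T(rq)=\sigma(r)T(q)$ and $\sigma(\psi(p\otimes q))=S(p)T(q)$ for all $r\in R,p\in P,q\in Q$. It is surjective if $B$ is generated as a ring by $\sigma(R)\cup S(P)\cup T(Q)$, and graded if it is surjective and $B$ carries a $\mathbb{Z}$-grading with $\sigma(R)\subseteq B_0$, $T(Q)\subseteq B_1$, $S(P)\subseteq B_{-1}$. Write $S^n(p_1\otimes\cdots\otimes p_n)=S(p_1)\cdots S(p_n)$, $T^n(q_1\otimes\cdots\otimes q_n)=T(q_1)\cdots T(q_n)$. For a graded covariant representation and $k\ge0$, $I^{(k)}_{\psi,\sigma}$ is the ideal of $B_0$ generated by $\{\sigma(\psi_k(p\otimes q)):p\in P^{\otimes k},q\in Q^{\otimes k}\}$; the representation is semi-full if $B_{-k}B_k=I^{(k)}_{\psi,\sigma}$ for all $k\ge0$. For $q\in Q,p\in P$ let $\theta_{q,p}:Q\to Q$, $x\mapsto q\psi(p\otimes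 x)$, and $\theta_{p,q}:P\to P$, $y\mapsto\psi(y\otimes q)p$. $\mathcal{F}_P(Q)$ (resp. $\mathcal{F}_Q(P)$) is the additive group generated by all $\theta_{q,p}$ (resp. $\theta_{p,q}$). Condition (FS): for all finite sets $\{q_i\}\subseteq Q$, $\{p_j\}\subseteq P$ there are $\Theta\in\mathcal{F}_P(Q)$, $\Phi\in\mathcal{F}_Q(P)$ with $\Theta(q_i)=q_i$, $\Phi(p_j)=p_j$ for all $i,j$. Let $\Delta:R\to\mathrm{End}(Q_R)$, $\Delta(r)(q)=rq$. Under (FS), for each covariant representation there is a unique ring homomorphism $\pi_{T,S}:\mathcal{F}_P(Q)\to B$ with $\pi_{T,S}(\theta_{q,p})=T(q)S(p)$. The Toeplitz representation $(\iota_P,\iota_Q,\iota_R,\mathcal{T}_{(P,Q,\psi)})$ is the universal covariant representation (for every covariant representation $(S,T,\sigma,B)$ there is a unique ring homomorphism $\eta$ with $\eta\iota_P=S$, $\eta\iota_Q=T$, $\eta\iota_R=\sigma$); it is graded with $\mathcal{T}_i$ the additive group generated by the elements $\iota_Q^m(q)\iota_P^n(p)$ and $\iota_R(r)\iota_Q^m(q)\iota_P^n(p)$ with $q\in Q^{\otimes m},p\in P^{\otimes n}$, $m-n=i$ (with $\iota^0=\iota_R$). Assume (FS) and let $\pi=\pi_{\iota_Q,\iota_P}$. An ideal $J\subseteq R$ is $\psi$-compatible if $\Delta(J)\subseteq\mathcal{F}_P(Q)$ and faithful if $J\cap\ker\Delta=\{0\}$. For $\psi$-compatible $J$, $\mathcal{T}(J)$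 is the ideal of $\mathcal{T}_{(P,Q,\psi)}$ generated by $\{\iota_R(x)-\pi(\Delta(x)):x\in J\}$, $\mathcal{O}_{(P,Q,\psi)}(J)=\mathcal{T}_{(P,Q,\psi)}/\mathcal{T}(J)$ with quotient map $\rho$ and grading $\rho(\mathcal{T}_i)$, and $(\rho\iota_P,\rho\iota_Q,\rho\iota_R,\mathcal{O}(J))$ is the relative Cuntz–Pimsner representation. If there is a unique maximal $\psi$-compatible faithful ideal $J$, the Cuntz–Pimsner ring is (well-defined and equal to) $\mathcal{O}_{(P,Q,\psi)}=\mathcal{O}_{(P,Q,\psi)}(J)$, with Cuntz–Pimsner representation $(\iota^{CP}_P,\iota^{CP}_Q,\iota^{CP}_R,\mathcal{O}_{(P,Q,\psi)})$ the corresponding relative representation. *)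

(* Defs.v *)
From Stdlib Require Import ZArith List.
Import ListNotations.
Open Scope Z_scope.
Set Implicit Arguments.
Unset Strict Implicit.

Record Ring := {
  car :> Type;
  rzero : car;
  radd : car -> car -> car;
  ropp : car -> car;
  rmul : car -> car -> car;
  raddA : forall x y z, radd x (radd y z) = radd (radd x y) z;
  raddC : forall x y, radd x y = radd y x;
  radd0 : forall x, radd rzero x = x;
  raddN : forall x, radd (ropp x) x = rzero;
  rmulA : forall x y z, rmul x (rmul y z) = rmul (rmul x y) z;
  rmulDl : forall x y z, rmul (radd x y) z = radd (rmul x z) (rmul y z);
  rmulDr : forall x y z, rmul x (radd y z) = radd (rmul x y) (rmul x z)
}.
Arguments rzero {_}. Arguments radd {_}. Arguments ropp {_}. Arguments rmul {_}.

Definition ringhom (A B : Ring) (f : A -> B) : Prop :=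
  (forall x y, f (radd x y) = radd (f x) (f y)) /\
  (forall x y, f (rmul x y) = rmul (f x) (f y)).

Inductive span (B : Ring) (X : B -> Prop) : B -> Prop :=
| span_in : forall x, X x -> span X x
| span_zero : span X rzero
| span_add : forall x y, span X x -> span X y -> span X (radd x y)
| span_opp : forall x, span X x -> span X (ropp x).

Definition prodspan (B : Ring) (X Y : B -> Prop) : B -> Prop :=
  span (fun z => exists x y, X x /\ Y y /\ z = rmul x y).

Inductive idealgen_in (B : Ring) (S X : B -> Prop) : B -> Prop :=
| ig_in : forall x, X x -> idealgen_in S X x
| ig_zero : idealgen_in S X rzero
| ig_add : forall x y, idealgen_in S X x -> idealgen_in S X y -> idealgen_in S X (radd x y)
| ig_opp : forall x, idealgen_in S X x -> idealgen_in S X (ropp x)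
| ig_mull : forall b x, S b -> idealgen_in S X x -> idealgen_in S X (rmul b x)
| ig_mulr : forall b x, S b -> idealgen_in S X x -> idealgen_in S X (rmul x b).

Definition idealgen (B : Ring) (X : B -> Prop) := idealgen_in (fun _ => True) X.

Definition is_ideal (B : Ring) (J : B -> Prop) : Prop :=
  J rzero /\ (forall x y, J x -> J y -> J (radd x y)) /\ (forall x, J x -> J (ropp x)) /\
  (forall r x, J x -> J (rmul r x)) /\ (forall r x, J x -> J (rmul x r)).

Definition s_unital_ideal (B : Ring) (I : B -> Prop) : Prop :=
  forall x, I x -> exists a b, I a /\ I b /\ rmul a x = x /\ rmul x b = x.

Definition s_unital_ring (B : Ring) : Prop :=
  forall x : B, exists a b, rmul a x = x /\ rmul x b = x.

Definition nearly_eps_strongly (B : Ring) (G : Z -> B -> Prop) : Prop :=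
  forall i x, G i x ->
    exists a b, prodspan (G i) (G (- i)) a /\ prodspan (G (- i)) (G i) b /\
                rmul a x = x /\ rmul x b = x.

Definition Ann (B : Ring) (G : Z -> B -> Prop) (r : B) : Prop :=
  G 0 r /\ forall a, G 1 a -> rmul r a = rzero.
Definition perp (B : Ring) (G : Z -> B -> Prop) (J : B -> Prop) (r : B) : Prop :=
  G 0 r /\ forall x, J x -> rmul r x = rzero /\ rmul x r = rzero.
Definition ann_condition (B : Ring) (G : Z -> B -> Prop) : Prop :=
  forall r, Ann G r -> perp G (Ann G) r -> r = rzero.

Definition graded_iso (A B : Ring) (GA : Z -> A -> Prop) (GB : Z -> B -> Prop) : Prop :=
  exists (f : A -> B) (g : B -> A), ringhom f /\ ringhom g /\
    (forall x, g (f x) = x) /\ (forall y, f (g y) = y) /\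
    (forall i x, GA i x -> GB i (f x)) /\ (forall i y, GB i y -> GA i (g y)).

Record Bimod (R : Ring) := {
  mcar :> Type;
  mzero : mcar;
  madd : mcar -> mcar -> mcar;
  mopp : mcar -> mcar;
  lact : R -> mcar -> mcar;
  ract : mcar -> R -> mcar;
  maddA : forall x y z, madd x (madd y z) = madd (madd x y) z;
  maddC : forall x y, madd x y = madd y x;
  madd0 : forall x, madd mzero x = x;
  maddN : forall x, madd (mopp x) x = mzero;
  lactDl : forall r s x, lact (radd r s) x = madd (lact r x) (lact s x);
  lactDr : forall r x y, lact r (madd x y) = madd (lact r x) (lact r y);
  ractDl : forall x y r, ract (madd x y) r = madd (ract x r) (ract y r);
  ractDr : forall x r s, ract x (radd r s) = madd (ract x r) (ract x s);
  lactA : forall r s x, lact (rmul r s) x = lact r (lact s x);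
  ractA : forall x r s, ract x (rmul r s) = ract (ract x r) s;
  lractA : forall r x s, ract (lact r x) s = lact r (ract x s)
}.
Arguments mzero {_ _}. Arguments madd {_ _}. Arguments mopp {_ _}.
Arguments lact {_ _}. Arguments ract {_ _}.

Definition s_unital_bimod (R : Ring) (M : Bimod R) : Prop :=
  forall x : M, exists a b : R, lact a x = x /\ ract x b = x.

(* ---------- R-systems ----------
   psi : P (x)_R Q -> R bimodule map  <->  R-balanced biadditive map
   P x Q -> R, left R-linear in P and right R-linear in Q. *)
Record System (R : Ring) := {
  sP : Bimod R;
  sQ : Bimod R;
  psi : sP -> sQ -> R;
  psi_addl : forall p p' q, psi (madd p p') q = radd (psi p q) (psi p' q);
  psi_addr : forall p q q', psi p (madd q q') = radd (psi p q) (psi p q');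
  psi_bal : forall p r q, psi (ract p r) q = psi p (lact r q);
  psi_lin_l : forall r p q, psi (lact r p) q = rmul r (psi p q);
  psi_lin_r : forall p q r, psi p (ract q r) = rmul (psi p q) r
}.
Arguments sP {_}. Arguments sQ {_}. Arguments psi {_}.

Definition s_unital_system (R : Ring) (sy : System R) : Prop :=
  s_unital_ring R /\ s_unital_bimod (sP sy) /\ s_unital_bimod (sQ sy).

(* psi_k on elementary tensors: for k >= 1, p = p1 (x) ... (x) pk, and
   q = qk (x) ... (x) q1 (the list [q1;..;qk]);
   psi_k(p (x) q) = psi(p1 psi_{k-1}(p2.. (x) ..q2) (x) q1). *)
Fixpoint psik (R : Ring) (sy : System R) (p : sP sy) (q : sQ sy)
         (ps : list (sP sy)) (qs : list (sQ sy)) : R :=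
  match ps, qs with
  | p' :: ps', q' :: qs' => psi sy (ract p (psik p' q' ps' qs')) q
  | _, _ => psi sy p q
  end.

(* theta sums: elements of F_P(Q) and F_Q(P) are the finite sums of theta's
   (the theta's are additive in their first index, so signs are absorbed) *)
Definition thetaQ (R : Ring) (sy : System R) (l : list (sQ sy * sP sy)) (x : sQ sy) : sQ sy :=
  fold_right (fun qp acc => madd (ract (fst qp) (psi sy (snd qp) x)) acc) mzero l.
Definition thetaP (R : Ring) (sy : System R) (l : list (sP sy * sQ sy)) (y : sP sy) : sP sy :=
  fold_right (fun pq acc => madd (lact (psi sy y (snd pq)) (fst pq)) acc) mzero l.

Definition in_FPQ (R : Ring) (sy : System R) (f : sQ sy -> sQ sy) : Prop :=
  exists l, forall x, f x = thetaQ l x.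
Definition in_FQP (R : Ring) (sy : System R) (f : sP sy -> sP sy) : Prop :=
  exists l, forall y, f y = thetaP l y.

Definition condFS (R : Ring) (sy : System R) : Prop :=
  forall (qs : list (sQ sy)) (ps : list (sP sy)),
    (exists Th, in_FPQ Th /\ forall q, In q qs -> Th q = q) /\
    (exists Ph, in_FQP Ph /\ forall p, In p ps -> Ph p = p).

Definition Delta (R : Ring) (sy : System R) (x : R) : sQ sy -> sQ sy := fun q => lact x q.
Arguments Delta {R} sy x _.

Definition compat_faithful (R : Ring) (sy : System R) (J : R -> Prop) : Prop :=
  is_ideal J /\ (forall x, J x -> in_FPQ (Delta sy x)) /\
  (forall x, J x -> (forall q, Delta sy x q = mzero) -> x = rzero).

Definition maximal_cf (R : Ring) (sy : System R) (J : R -> Prop) : Prop :=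
  compat_faithful sy J /\
  forall J', compat_faithful sy J' -> (forall x, J x -> J' x) -> forall x, J' x -> J x.

Definition CP_welldef (R : Ring) (sy : System R) : Prop :=
  exists J, maximal_cf sy J /\ forall J', maximal_cf sy J' -> forall x, J' x <-> J x.

Definition covrep (R : Ring) (sy : System R) (B : Ring)
  (S : sP sy -> B) (T : sQ sy -> B) (sg : R -> B) : Prop :=
  (forall p p', S (madd p p') = radd (S p) (S p')) /\
  (forall q q', T (madd q q') = radd (T q) (T q')) /\
  ringhom sg /\
  (forall p r, S (ract p r) = rmul (S p) (sg r)) /\
  (forall r p, S (lact r p) = rmul (sg r) (S p)) /\
  (forall q r, T (ract q r) = rmul (T q) (sg r)) /\
  (forall r q, T (lact r q) = rmul (sg r) (T q)) /\
  (forall p q, sg (psi sy p q) = rmul (S p) (T q)).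

Definition is_toeplitz (R : Ring) (sy : System R) (B : Ring)
  (S : sP sy -> B) (T : sQ sy -> B) (sg : R -> B) : Prop :=
  covrep S T sg /\
  forall (B' : Ring) (S' : sP sy -> B') (T' : sQ sy -> B') (sg' : R -> B'),
    covrep S' T' sg' ->
    (exists eta : B -> B', ringhom eta /\ (forall p, eta (S p) = S' p) /\
        (forall q, eta (T q) = T' q) /\ (forall r, eta (sg r) = sg' r)) /\
    (forall e1 e2 : B -> B',
        ringhom e1 /\ (forall p, e1 (S p) = S' p) /\ (forall q, e1 (T q) = T' q) /\
          (forall r, e1 (sg r) = sg' r) ->
        ringhom e2 /\ (forall p, e2 (S p) = S' p) /\ (forall q, e2 (T q) = T' q) /\
          (forall r, e2 (sg r) = sg' r) ->
        forall x, e1 x = e2 x).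

Inductive gen (R : Ring) (sy : System R) :=
| gR : R -> gen sy | gP : sP sy -> gen sy | gQ : sQ sy -> gen sy.
Arguments gR {_ _}. Arguments gP {_ _}. Arguments gQ {_ _}.

Definition gdeg (R : Ring) (sy : System R) (g : gen sy) : Z :=
  match g with gR _ => 0 | gP _ => -1 | gQ _ => 1 end.
Definition gval (R : Ring) (sy : System R) (B : Ring)
  (S : sP sy -> B) (T : sQ sy -> B) (sg : R -> B) (g : gen sy) : B :=
  match g with gR r => sg r | gP p => S p | gQ q => T q end.
Fixpoint prodl (B : Ring) (x : B) (l : list B) : B :=
  match l with [] => x | y :: l' => rmul x (prodl y l') end.

Definition Tgrad (R : Ring) (sy : System R) (B : Ring)
  (S : sP sy -> B) (T : sQ sy -> B) (sg : R -> B) (i : Z) : B -> Prop :=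
  span (fun y => exists (g : gen sy) (l : list (gen sy)),
          gdeg g + fold_right (fun h acc => gdeg h + acc) 0 l = i /\
          y = prodl (gval S T sg g) (map (gval S T sg) l)).

(* T(J): ideal generated by  sg(x) - pi(Delta(x)),  x in J; pi(sum theta_{q,p}) = sum T(q)S(p) *)
Definition piSum (R : Ring) (sy : System R) (B : Ring)
  (S : sP sy -> B) (T : sQ sy -> B) (l : list (sQ sy * sP sy)) : B :=
  fold_right (fun qp acc => radd (rmul (T (fst qp)) (S (snd qp))) acc) rzero l.

Definition TJ (R : Ring) (sy : System R) (B : Ring)
  (S : sP sy -> B) (T : sQ sy -> B) (sg : R -> B) (J : R -> Prop) : B -> Prop :=
  idealgen (fun y => exists x l, J x /\ (forall q, Delta sy x q = thetaQ l q) /\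
                                 y = radd (sg x) (ropp (piSum S T l))).

Definition is_CP_ring (R : Ring) (sy : System R) (B : Ring)
  (S : sP sy -> B) (T : sQ sy -> B) (sg : R -> B) (O : Ring) (rho : B -> O) : Prop :=
  CP_welldef sy /\ is_toeplitz S T sg /\
  exists J, maximal_cf sy J /\
    ringhom rho /\ (forall y : O, exists x, rho x = y) /\
    (forall x, rho x = rzero <-> TJ S T sg J x).

Definition Ograd (R : Ring) (sy : System R) (B : Ring)
  (S : sP sy -> B) (T : sQ sy -> B) (sg : R -> B) (O : Ring) (rho : B -> O)
  (i : Z) : O -> Prop :=
  fun y => exists x, Tgrad S T sg i x /\ y = rho x.

Definition Ik (R : Ring) (sy : System R) (C : Ring) (sg : R -> C)
  (G : Z -> C -> Prop) (k : nat) : C -> Prop :=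
  idealgen_in (G 0)
    (fun y => match k with
              | O => exists r r' : R, y = sg (rmul r r')
              | S k' => exists (p : sP sy) (q : sQ sy) ps qs, length ps = k' /\ length qs = k' /\
                          y = sg (psik p q ps qs)
              end).

Definition semi_full (R : Ring) (sy : System R) (C : Ring) (sg : R -> C)
  (G : Z -> C -> Prop) : Prop :=
  forall k : nat, forall x, prodspan (G (- Z.of_nat k)) (G (Z.of_nat k)) x <-> Ik sy sg G k x.

(* Main.v *)
Require Import Defs.
From Stdlib Require Import ZArith List Lia ssreflect.
From Stdlib Require Import ClassicalEpsilon FunctionalExtensionality
  PropExtensionality ProofIrrelevance.
Import ListNotations.
Set Implicit Arguments.
Unset Strict Implicit.

(** Converse.  Using (FS), a finite set of elements [V q_1 ... V q_m sg r U p_1 ... U p_n]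
with [m >= k] has a common left unit which is a sum of such elements with
[m = n = k], and symmetrically on the right.  So every [x] in [O_k], [k >= 0],
satisfies [x = sum_j u_j (v_j x)] with [u_j] in [O_k] and [v_j x] in
[O_(-k) O_k = I^(k)]; as [I^(k)] is s-unital, the [v_j x] have a common right
unit in it, which is then a right unit of [x].

Direct part.  Take [R' = O_0], [P' = O_(-1)], [Q' = O_1] with [psi'] the product
of [O].  The annihilator condition makes [O_1 O_(-1)] the largest compatible
faithful ideal.  It remains to see that the canonical map from the Toeplitz ring
onto [O] has kernel [T(O_1 O_(-1))].  Modulo this ideal every homogeneous element
is a combination of products only of elements of [Q'], or only of [P'], and
multiplying by local units [sum_j u_j v_j] in [O_1 O_(-1)] lowers the degree, so
injectivity follows by induction from degree 0. *)

(* The rings have no identity, only local units for finite sets. Hence an argument first extracts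
   from a sum the finite list of factors that a unit must fix, and then merges units one at a time.
   Mostly one side is proved and the other is its instance over the opposite ring, where [P] and [Q]
   trade places.

   The components of $O$ are given as images of those of the Toeplitz ring, and their independence
   is not part of the data. The induction on the degree handles homogeneous elements only, so
   injectivity on sums needs independence; this comes from the universal property, with a local unit
   playing the part of 1.

   The local units used in that induction live in $O$, while the elements that they must fix live in
   a quotient of the Toeplitz ring lying over $O$. The lift works because a unit for finitely many
   elements of $O_1$ fixes them as elements of $Q'$, hence fixes every product that begins with one
   of them. *)
Declare Scope nr_scope.
Delimit Scope nr_scope with nr.
Local Infix "+" := radd : nr_scope.
Local Infix "*" := rmul : nr_scope.
Local Notation "- x" := (ropp x) : nr_scope.
Local Notation "x - y" := (radd x (ropp y)) : nr_scope.
Local Notation "0" := rzero : nr_scope.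
Local Open Scope nr_scope.

(** * Non-unital rings *)

Section RingBasics.
Variable A : Ring.
Implicit Types x y z : A.

Lemma raddr0 x : x + 0 = x.
Proof. by rewrite raddC radd0. Qed.

Lemma raddrN x : x - x = 0.
Proof. by rewrite raddC raddN. Qed.

Lemma raddI x y z : x + y = x + z -> y = z.
Proof. by move=> E; rewrite -(radd0 y) -(raddN x) -raddA E raddA raddN radd0. Qed.

Lemma ropp_unique x y : x + y = 0 -> y = - x.
Proof. by move=> E; apply: (@raddI x); rewrite E raddrN. Qed.

Lemma ropp0 : - (0 : A) = 0.
Proof. by rewrite -{2}(raddrN 0) radd0. Qed.

Lemma roppK x : - - x = x.
Proof. by symmetry; apply: ropp_unique; rewrite raddN. Qed.

Lemma raddACA x y z t : (x + y) + (z + t) = (x + z) + (y + t).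
Proof. by rewrite -!raddA (raddA y) (raddC y z) -!raddA. Qed.

Lemma roppD x y : - (x + y) = - x - y.
Proof. by symmetry; apply: ropp_unique; rewrite raddACA !raddrN radd0. Qed.

Lemma rsub_eq0 x y : x - y = 0 <-> x = y.
Proof.
split=> [E|->]; last by rewrite raddrN.
by rewrite -(raddr0 x) -(raddN y) raddA E radd0.
Qed.

Lemma rmul0r x : 0 * x = 0.
Proof. by apply: (@raddI (0 * x)); rewrite -rmulDl radd0 raddr0. Qed.

Lemma rmulr0 x : x * 0 = 0.
Proof. by apply: (@raddI (x * 0)); rewrite -rmulDr radd0 raddr0. Qed.

Lemma rmulNr x y : - x * y = - (x * y).
Proof. by apply: ropp_unique; rewrite -rmulDl raddrN rmul0r. Qed.

Lemma rmulrN x y : x * - y = - (x * y).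
Proof. by apply: ropp_unique; rewrite -rmulDr raddrN rmulr0. Qed.

End RingBasics.

(** Transparent, so that a statement over the opposite ring converts to its mirror image over
    [A]. *)
Definition opp_ring (A : Ring) : Ring.
refine {| car := A; rzero := 0; radd := @radd A; ropp := @ropp A;
          rmul := fun x y : A => y * x |};
  [ exact: raddA | exact: raddC | exact: radd0 | exact: raddN
  | move=> x y z; exact: (eq_sym (rmulA z y x)) | move=> x y z; exact: rmulDr
  | move=> x y z; exact: rmulDl ].
Defined.

Definition additive (A B : Ring) (h : A -> B) := forall x y, h (x + y) = h x + h y.

Section Additive.
Variables (A B : Ring) (h : A -> B).
Hypothesis hD : additive h.

Lemma additive0 : h 0 = 0.
Proof. by apply: (@raddI _ (h 0)); rewrite -hD radd0 raddr0. Qed.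

Lemma additiveN x : h (- x) = - h x.
Proof. by apply: ropp_unique; rewrite -hD raddrN additive0. Qed.

Lemma additiveB x y : h (x - y) = h x - h y.
Proof. by rewrite hD additiveN. Qed.
End Additive.

Definition subgroup (A : Ring) (H : A -> Prop) :=
  H 0 /\ (forall x y, H x -> H y -> H (x + y)) /\ (forall x, H x -> H (- x)).

Lemma subgroup_preim (A B : Ring) (h : A -> B) (H : B -> Prop) :
  additive h -> subgroup H -> subgroup (fun x => H (h x)).
Proof.
move=> hD [H0 [HD HN]]; split; first by rewrite (additive0 hD).
split=> [x y hx hy|x hx]; first by rewrite hD; apply: HD.
by rewrite (additiveN hD); apply: HN.
Qed.

Lemma subgroup_span (A : Ring) (X : A -> Prop) : subgroup (span X).
Proof.
by split; [exact: span_zero | split; [exact: span_add | exact: span_opp]].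
Qed.

Lemma span_least (A : Ring) (X H : A -> Prop) :
  subgroup H -> (forall x, X x -> H x) -> forall x, span X x -> H x.
Proof.
move=> [H0 [HD HN]] XH x; elim=> {x} [x|||] //; first exact: XH.
- by move=> x y _ hx _ hy; apply: HD.
- by move=> x _ hx; apply: HN.
Qed.

Lemma span_map (A B : Ring) (h : A -> B) (X : A -> Prop) (Y : B -> Prop) :
  additive h -> (forall x, X x -> span Y (h x)) ->
  forall x, span X x -> span Y (h x).
Proof.
move=> hD XY; apply: span_least => //.
exact: subgroup_preim hD (subgroup_span _).
Qed.

Lemma mul_l_additive (A : Ring) (a : A) : additive (fun x => a * x).
Proof. by move=> x y; rewrite rmulDr. Qed.

Lemma mul_r_additive (A : Ring) (a : A) : additive (fun x => x * a).
Proof. by move=> x y; rewrite rmulDl. Qed.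

Lemma prodspan_mul (A : Ring) (X Y : A -> Prop) x y : X x -> Y y -> prodspan X Y (x * y).
Proof. by move=> hx hy; apply: span_in; exists x, y. Qed.

Lemma span_mul_least (A : Ring) (X Y H : A -> Prop) :
  subgroup H -> (forall x y, X x -> Y y -> H (x * y)) ->
  forall x y, span X x -> span Y y -> H (x * y).
Proof.
move=> sH XYH x y hx hy; move: x hx.
apply: span_least; first exact: (subgroup_preim (mul_r_additive y) sH).
move=> x hx; move: y hy.
apply: span_least; first exact: (subgroup_preim (mul_l_additive x) sH).
by move=> y hy; apply: XYH.
Qed.

Lemma prodspan_opp (A : Ring) (X Y : A -> Prop) x :
  @prodspan (opp_ring A) X Y x <-> prodspan Y X x.
Proof.
split.
- apply: (@span_least (opp_ring A)); first exact: (subgroup_span (A := A)).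
  by move=> _ [u [v [hu [hv ->]]]]; apply: prodspan_mul.
- apply: span_least; first exact: (subgroup_span (A := opp_ring A)).
  by move=> _ [u [v [hu [hv ->]]]]; apply: (@prodspan_mul (opp_ring A)).
Qed.

(** Only finitely many generators occur in [x], so finding a left unit of [x] becomes finding a
    common left unit of a list. *)
Lemma span_fix (A : Ring) (X : A -> Prop) x :
  span X x -> exists L : list A, (forall y, In y L -> X y) /\
    forall a, (forall y, In y L -> a * y = y) -> a * x = x.
Proof.
elim=> {x} [x hx||x y _ [L1 [h1 f1]] _ [L2 [h2 f2]]|x _ [L [hL fL]]].
- exists [x]; split; first by move=> y [<-|[]].
  by move=> a; apply; left.
- by exists []; split=> // a _; rewrite rmulr0.
- exists (L1 ++ L2); split.
    by move=> z /in_app_iff [/h1|/h2].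
  move=> a fa; rewrite rmulDr f1 ?f2 // => z hz; apply: fa; apply/in_app_iff; tauto.
- by exists L; split=> // a fa; rewrite rmulrN fL.
Qed.

Lemma span_fix_right (A : Ring) (X : A -> Prop) x :
  span X x -> exists L : list A, (forall y, In y L -> X y) /\
    forall a, (forall y, In y L -> y * a = y) -> x * a = x.
Proof.
move=> hx; apply: (@span_fix (opp_ring A)); move: x hx.
apply: span_least => [|x hx]; last exact: span_in.
exact: (subgroup_span (A := opp_ring A)).
Qed.

(* Tominaga's trick: [1 - e = (1 - e2) (1 - e1)]. *)
Lemma common_left_unit (A : Ring) (E X : A -> Prop) :
  subgroup E -> (forall d e, E d -> E e -> E (d * e)) ->
  (forall x, X x -> exists e, E e /\ e * x = x) ->
  (forall e x, E e -> X x -> X (x - e * x)) ->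
  forall L : list A, (forall x, In x L -> X x) ->
    exists e, E e /\ forall x, In x L -> e * x = x.
Proof.
move=> [E0 [ED EN]] EM unitX stX L.
elim: L => [|x L IH] hL; first by exists 0.
case: IH => [z hz|e1 [he1 f1]]; first by apply: hL; right.
case: (unitX (x - e1 * x)) => [|e2 [he2 f2]].
  by apply: stX => //; apply: hL; left.
exists (e1 + (e2 - e2 * e1)); split.
  by apply: (ED _ _ _ (ED _ _ _ (EN _ (EM _ _ _ _)))).
move=> y [<-|hy].
  have -> : (e1 + (e2 - e2 * e1)) * x = e1 * x + e2 * (x - e1 * x).
    by rewrite rmulDl rmulDl rmulNr rmulDr rmulrN rmulA.
  by rewrite f2 raddC -raddA raddN raddr0.
by rewrite rmulDl rmulDl rmulNr -rmulA (f1 _ hy) raddrN raddr0.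
Qed.

Lemma common_right_unit (A : Ring) (E X : A -> Prop) :
  subgroup E -> (forall d e, E d -> E e -> E (d * e)) ->
  (forall x, X x -> exists e, E e /\ x * e = x) ->
  (forall e x, E e -> X x -> X (x - x * e)) ->
  forall L : list A, (forall x, In x L -> X x) ->
    exists e, E e /\ forall x, In x L -> x * e = x.
Proof.
move=> sE EM; apply: (@common_left_unit (opp_ring A)) => //.
by move=> d e hd he; apply: EM.
Qed.

Lemma transfer_right_unit (A : Ring) (X Y : A -> Prop) (x a : A) :
  (forall L, (forall z, In z L -> prodspan Y X z) ->
     exists b, prodspan Y X b /\ forall z, In z L -> z * b = z) ->
  X x -> prodspan X Y a -> a * x = x ->
  exists b, prodspan Y X b /\ x * b = x.
Proof.
move=> units hx ha ax.
have [L [hL fL]] : exists L, (forall v, In v L -> Y v) /\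
    forall b, (forall v, In v L -> (v * x) * b = v * x) -> (a * x) * b = a * x.
{ elim: ha => {a ax} [_ [u [v [hu [hv ->]]]]||a1 a2 _ [L1 [h1 f1]] _ [L2 [h2 f2]]|a _ [L [hL fL]]].
  - exists [v]; split; first by move=> z [<-|[]].
    by move=> b fb; rewrite -!rmulA; congr (u * _); rewrite rmulA; apply: fb; left.
  - by exists []; split=> // b _; rewrite !rmul0r.
  - exists (L1 ++ L2); split.
      by move=> z /in_app_iff [/h1|/h2].
    move=> b fb; rewrite !rmulDl f1 ?f2 // => z hz; apply: fb; apply/in_app_iff; tauto.
  - by exists L; split=> // b fb; rewrite !rmulNr fL. }
case: (units (map (fun v => v * x) L)).
  by move=> _ /in_map_iff [v [<- hv]]; apply: prodspan_mul => //; apply: hL.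
move=> b [hb fb]; exists b; split=> //.
rewrite -ax; apply: fL => v hv; apply: fb.
by apply: (in_map (fun v => v * x)).
Qed.

Lemma transfer_left_unit (A : Ring) (X Y : A -> Prop) (x b : A) :
  (forall L, (forall z, In z L -> prodspan X Y z) ->
     exists a, prodspan X Y a /\ forall z, In z L -> a * z = z) ->
  X x -> prodspan Y X b -> x * b = x ->
  exists a, prodspan X Y a /\ a * x = x.
Proof.
move=> units hx hb xb.
have [||a [/prodspan_opp ha fa]] :=
    @transfer_right_unit (opp_ring A) X Y x b _ hx _ xb; last by exists a.
- move=> L hL; case: (units L) => [z /hL /prodspan_opp //|a [ha fa]].
  by exists a; split=> //; apply/prodspan_opp.
- exact/prodspan_opp.
Qed.

(** * Covariant representations *)

Definition opp_bimod (R : Ring) (M : Bimod R) : Bimod (opp_ring R).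
refine (@Build_Bimod (opp_ring R) M mzero madd mopp
  (fun r x => @ract R M x r) (fun x r => @lact R M r x)
  (@maddA _ M) (@maddC _ M) (@madd0 _ M) (@maddN _ M) _ _ _ _ _ _ _).
- by move=> r s x; exact: ractDr.
- by move=> r x y; exact: ractDl.
- by move=> x y r; exact: lactDr.
- by move=> x r s; exact: lactDl.
- by move=> r s x; exact: ractA.
- by move=> x r s; exact: lactA.
- by move=> r x s; symmetry; exact: lractA.
Defined.

(** The two modules must be exchanged: over the opposite ring the pairing is linear on the left in
    [Q] and on the right in [P]. Statements about positive degrees thereby yield those about
    negative degrees. *)
Definition opp_system (R : Ring) (sy : System R) : System (opp_ring R).
refine (@Build_System (opp_ring R) (opp_bimod (sQ sy)) (opp_bimod (sP sy))
  (fun q p => psi sy p q) _ _ _ _ _).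
- by move=> q q' p; exact: (@psi_addr R sy).
- by move=> q p p'; exact: (@psi_addl R sy).
- by move=> q r p; symmetry; exact: (@psi_bal R sy).
- by move=> r q p; exact: (@psi_lin_r R sy).
- by move=> q p r; exact: (@psi_lin_l R sy).
Defined.

Lemma opp_condFS (R : Ring) (sy : System R) : condFS sy -> condFS (opp_system sy).
Proof. by move=> FS qs ps; case: (FS ps qs) => hQ hP; split. Qed.

Lemma opp_s_unital (R : Ring) (sy : System R) :
  s_unital_system sy -> s_unital_system (opp_system sy).
Proof.
move=> [uR [uP uQ]]; split; [|split].
- by move=> r; case: (uR r) => a [b [ha hb]]; exists b, a.
- by move=> q; case: (uQ q) => a [b [ha hb]]; exists b, a.
- by move=> p; case: (uP p) => a [b [ha hb]]; exists b, a.
Qed.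

Lemma opp_covrep (R : Ring) (sy : System R) (C : Ring)
    (U : sP sy -> C) (V : sQ sy -> C) (sg : R -> C) :
  covrep U V sg -> @covrep (opp_ring R) (opp_system sy) (opp_ring C) V U sg.
Proof.
move=> [UD [VD [[sD sM] [Ur [Ul [Vr [Vl UV]]]]]]].
repeat split=> //; first by move=> x y; exact: sM.
all: by move=> x y; first [exact: Vl | exact: Vr | exact: Ul | exact: Ur | exact: UV].
Qed.

(* [NF m n] consists of the elements
   [V q_1 ... V q_m * sg r * U p_1 ... U p_n]. *)
Inductive NF (R : Ring) (sy : System R) (C : Ring)
    (U : sP sy -> C) (V : sQ sy -> C) (sg : R -> C) : nat -> nat -> C -> Prop :=
| NF_R r : NF U V sg 0 0 (sg r)
| NF_Q m n q x : NF U V sg m n x -> NF U V sg (S m) n (V q * x)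
| NF_P m n x p : NF U V sg m n x -> NF U V sg m (S n) (x * U p).

Section Covrep.
Variables (R : Ring) (sy : System R) (C : Ring).
Variables (U : sP sy -> C) (V : sQ sy -> C) (sg : R -> C).
Hypothesis cr : covrep U V sg.
Implicit Types (p : sP sy) (q : sQ sy) (r : R) (x y z : C).

Let UD p p' : U (madd p p') = U p + U p'.
Proof. by case: cr. Qed.
Let VD q q' : V (madd q q') = V q + V q'.
Proof. by case: cr => _ []. Qed.
Let sgD : additive sg.
Proof. by case: cr => _ [_ [[]]]. Qed.
Let sgM r r' : sg (r * r') = sg r * sg r'.
Proof. by case: cr => _ [_ [[]]]. Qed.
Let Ur p r : U (ract p r) = U p * sg r.
Proof. by case: cr => _ [_ [_ []]]. Qed.
Let Ul p r : U (lact r p) = sg r * U p.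
Proof. by case: cr => _ [_ [_ [_ []]]]. Qed.
Let Vr q r : V (ract q r) = V q * sg r.
Proof. by case: cr => _ [_ [_ [_ [_ []]]]]. Qed.
Let Vl q r : V (lact r q) = sg r * V q.
Proof. by case: cr => _ [_ [_ [_ [_ [_ []]]]]]. Qed.
Let UV p q : sg (psi sy p q) = U p * V q.
Proof. by case: cr => _ [_ [_ [_ [_ [_ []]]]]]. Qed.

Lemma covrep_V0 : V mzero = 0.
Proof. by apply: (@raddI _ (V mzero)); rewrite -VD madd0 raddr0. Qed.

Lemma covrep_VN q : V (mopp q) = - V q.
Proof. by apply: ropp_unique; rewrite -VD maddC maddN covrep_V0. Qed.

Local Notation Tg := (Tgrad U V sg).
Local Notation val := (gval U V sg).

Lemma Tgrad_letter g : Tg (gdeg g) (val g).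
Proof. by apply: span_in; exists g, []; split=> //=; lia. Qed.

Lemma Tgrad_cons g i x : Tg i x -> Tg (gdeg g + i) (val g * x).
Proof.
move: x; apply: span_map; first exact: mul_l_additive.
move=> _ [h [l [<- ->]]]; apply: span_in; exists g, (h :: l).
by split.
Qed.

(** Induction over words: a family of subgroups has to be tested only on single letters and on left
    multiplication by a letter. *)
Lemma Tgrad_least (H : Z -> C -> Prop) :
  (forall i, subgroup (H i)) ->
  (forall g, H (gdeg g) (val g)) ->
  (forall g i x, H i x -> H (gdeg g + i)%Z (val g * x)) ->
  forall i x, Tg i x -> H i x.
Proof.
move=> sH H1 Hc i; apply: span_least => // x [g [l [<- ->]]].
elim: l g => [|h l IH] g /=; first by rewrite Z.add_0_r.
exact: Hc (IH h).
Qed.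

Lemma Tgrad_mul i j x y : Tg i x -> Tg j y -> Tg (i + j) (x * y).
Proof.
move=> hx hy; move: i x hx.
apply: (@Tgrad_least (fun i x => Tg (i + j) (x * y))).
- by move=> i; exact: (subgroup_preim (mul_r_additive y) (subgroup_span _)).
- by move=> g; apply: Tgrad_cons.
- by move=> g i x hx; rewrite -Z.add_assoc -rmulA; apply: Tgrad_cons.
Qed.

Lemma Tgrad_R r : Tg 0 (sg r).
Proof. exact: (Tgrad_letter (gR r)). Qed.
Lemma Tgrad_P p : Tg (-1) (U p).
Proof. exact: (Tgrad_letter (gP p)). Qed.
Lemma Tgrad_Q q : Tg 1 (V q).
Proof. exact: (Tgrad_letter (gQ q)). Qed.

Local Notation NFc := (NF U V sg).

Lemma NF_Tgrad m n x : NFc m n x -> Tg (Z.of_nat m - Z.of_nat n) x.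
Proof.
elim=> {m n x} [r|m n q x _ hx|m n x p _ hx]; first exact: Tgrad_R.
- have -> : (Z.of_nat (S m) - Z.of_nat n = 1 + (Z.of_nat m - Z.of_nat n))%Z by lia.
  exact: Tgrad_mul (Tgrad_Q q) hx.
- have -> : (Z.of_nat m - Z.of_nat (S n) = (Z.of_nat m - Z.of_nat n) + -1)%Z by lia.
  exact: Tgrad_mul hx (Tgrad_P p).
Qed.

Lemma NF_lact r m n x : NFc m n x -> NFc m n (sg r * x).
Proof.
elim=> {m n x} [r'|m n q x hx _|m n x p _ hx].
- by rewrite -sgM; constructor.
- by rewrite rmulA -Vl; constructor.
- by rewrite rmulA; constructor.
Qed.

Lemma NF_SQ_inv m n x : NFc (S m) n x -> exists q y, NFc m n y /\ x = V q * y.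
Proof.
move E: (S m) => k h; elim: h E => {k n x} [//|k n q x hx _ [->]|k n x p hx IH E].
  by exists q, x.
case: (IH E) => q [y [hy ->]]; exists q, (y * U p).
by rewrite rmulA; split=> //; constructor.
Qed.

Lemma NF_P_mul m n p x : NFc (S m) n x -> NFc m n (U p * x).
Proof.
case/NF_SQ_inv => q [y [hy ->]].
by rewrite rmulA -UV; apply: NF_lact.
Qed.

(** The inclusion of $I^{(k)}$ in $O_{-k}O_k$ on generators: unfolding [psik] from the outside wraps
    the inner value between [U p] and [V q]. *)
Lemma psik_prodspan p q ps qs : length ps = length qs ->
  let k := Z.of_nat (S (length ps)) in
  prodspan (Tg (- k)) (Tg k) (sg (psik p q ps qs)).
Proof.
elim: ps p q qs => [|p' ps IH] p q [|q' qs] //=.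
  by move=> _; rewrite UV; apply: prodspan_mul; [exact: Tgrad_P | exact: Tgrad_Q].
case=> E; rewrite UV Ur; move: (IH p' q' qs E).
apply: (@span_map _ _ (fun c => U p * c * V q)).
  by move=> c d; rewrite rmulDr rmulDl.
move=> _ [y [z [hy [hz ->]]]].
rewrite rmulA -rmulA; apply: prodspan_mul.
- have := Tgrad_mul (Tgrad_P p) hy; congr (Tg _ _); lia.
- have := Tgrad_mul hz (Tgrad_Q q); congr (Tg _ _); lia.
Qed.

Section SUnital.
Hypothesis su : s_unital_system sy.

Lemma U_unit p : exists r s, U p = sg r * U p /\ U p = U p * sg s.
Proof. by case: su => _ [h _]; case: (h p) => a [b [ha hb]]; exists a, b; rewrite -Ul -Ur ha hb. Qed.

Lemma V_unit q : exists r s, V q = sg r * V q /\ V q = V q * sg s.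
Proof. by case: su => _ [_ h]; case: (h q) => a [b [ha hb]]; exists a, b; rewrite -Vl -Vr ha hb. Qed.

(** The coefficient of a normal form stands to the left of all factors [U]. Here it is first
    absorbed into [p], and s-unitality then supplies a new one on the left. *)
Lemma NF_P_cons n p x : NFc 0 n x -> NFc 0 (S n) (U p * x).
Proof.
move E: 0%nat => m h; elim: h E => {m n x} [r _|//|m n x p' _ IH E].
  case: (U_unit (ract p r)) => s [_ [e _]].
  by rewrite -Ur e; do 2!constructor.
by rewrite rmulA; constructor; apply: IH.
Qed.

Lemma NF00_inv x : NFc 0 0 x -> exists r, x = sg r.
Proof. by move=> h; inversion h; exists r. Qed.

(** The coefficient is absorbed into the first factor [U], and a right local unit of that factor
    becomes the coefficient of the rest. *)
Lemma NF_SP_inv_left n x : NFc 0 (S n) x -> exists p y, NFc 0 n y /\ x = U p * y.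
Proof.
elim: n x => [|n IH] x h; inversion h as [| |m n' y p hy]; subst.
  case: (NF00_inv hy) => r ->; case: (U_unit (lact r p)) => _ [s [_ e]].
  exists (lact r p), (sg s); split; first by constructor.
  by rewrite -e Ul.
case: (IH _ hy) => p' [z [hz ->]]; exists p', (z * U p).
by rewrite rmulA; split=> //; constructor.
Qed.

(** Normal ordering: [U p * V q = sg (psi p q)] removes every [U] standing before a [V], so the
    factors [V] end up on the left. *)
Lemma Tgrad_NF i x : Tg i x ->
  span (fun y => exists m n, Z.of_nat m - Z.of_nat n = i /\ NFc m n y)%Z x.
Proof.
move: i x; apply: (@Tgrad_least (fun i => span (fun y =>
  exists m n, Z.of_nat m - Z.of_nat n = i /\ NFc m n y)%Z)) => [i|[r|p|q]|g i].
- exact: subgroup_span.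
- by apply: span_in; exists 0%nat, 0%nat; split=> //; constructor.
- apply: span_in; exists 0%nat, 1%nat; split=> //.
  by rewrite /=; case: (U_unit p) => r [_ [-> _]]; do 2!constructor.
- apply: span_in; exists 1%nat, 0%nat; split=> //.
  by rewrite /=; case: (V_unit q) => _ [r [_ ->]]; do 2!constructor.
- apply: span_map; first exact: mul_l_additive.
  move=> x [m [n [<- h]]]; apply: span_in; case: g => [r|p|q].
  + by exists m, n; split; [rewrite /gdeg; lia | apply: NF_lact].
  + case: m h => [|m] h.
      by exists 0%nat, (S n); split; [rewrite /gdeg; lia | apply: NF_P_cons].
    by exists m, n; split; [rewrite /gdeg; lia | apply: NF_P_mul].
  + by exists (S m), n; split; [rewrite /gdeg; lia | constructor].
Qed.

(** A left local unit of the coefficient splits it into two, one for each half. *)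
Lemma NF_split m n x : NFc m n x ->
  exists y z, NFc m 0 y /\ NFc 0 n z /\ x = y * z.
Proof.
elim=> {m n x} [r|m n q x _ [y [z [hy [hz ->]]]]|m n x p _ [y [z [hy [hz ->]]]]].
- case: su => uR _; case: (uR r) => a [_ [ha _]].
  by exists (sg a), (sg r); rewrite -sgM ha; do !split; constructor.
- by exists (V q * y), z; rewrite rmulA; do !split=> //; constructor.
- by exists y, (z * U p); rewrite rmulA; do !split=> //; constructor.
Qed.

Lemma NF_prodspan k x : NFc k k x -> prodspan (Tg (Z.of_nat k)) (Tg (- Z.of_nat k)) x.
Proof.
case/NF_split => y [z [/NF_Tgrad hy [/NF_Tgrad hz ->]]]; apply: prodspan_mul.
- by move: hy; congr (Tg _ _); lia.
- by move: hz; congr (Tg _ _); lia.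
Qed.

(** Induction on [k]. Write the members of [L] as [V q * y]. By (FS) some sum of operators theta,
    given by pairs [(q_t, p_t)], fixes all these [q]; let [a] be a unit of level [k] for all
    [sg (psi p_t q) * y]. Then the sum of the [V q_t * a * U p_t] is a unit of level [k + 1]. *)
Lemma NF_left_unit (FS : condFS sy) k (L : list C) :
  (forall x, In x L -> exists m n, (k <= m)%nat /\ NFc m n x) ->
  exists a, span (NFc k k) a /\ forall x, In x L -> a * x = x.
Proof.
elim: k L => [|k IH] L hL.
(* The class of elements to be fixed must be stable under [x - e * x] with [e] in the image of [sg].
   Recording only the leading factor, with an arbitrary [y] behind it, achieves this. *)
{ case: (@common_left_unit C (span (NFc 0 0))
    (fun x => (exists r y, x = sg r * y) \/ exists q y, x = V q * y) _ _ _ _ L).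
  - exact: subgroup_span.
  - move=> d e; apply: span_mul_least; first exact: subgroup_span.
    move=> _ _ /NF00_inv [r ->] /NF00_inv [s ->].
    by rewrite -sgM; apply: span_in; constructor.
  - move=> _ [[r [y ->]]|[q [y ->]]].
      case: su => uR _; case: (uR r) => a [_ [ha _]]; exists (sg a).
      by rewrite rmulA -sgM ha; split=> //; apply: span_in; constructor.
    case: (V_unit q) => r [_ [e _]]; exists (sg r).
    by rewrite rmulA -e; split=> //; apply: span_in; constructor.
  - move=> e x he hx.
    have [r ->] : exists r, e = sg r.
      move: e he; apply: span_least; last by move=> e /NF00_inv.
      split; first by exists 0; rewrite (additive0 sgD).
      split=> [_ _ [r ->] [s ->]|_ [r ->]]; first by exists (r + s); rewrite sgD.
      by exists (- r); rewrite (additiveN sgD).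
    case: hx => [[s [y ->]]|[q [y ->]]].
      left; exists (s - r * s), y.
      by rewrite (additiveB sgD) rmulDl rmulNr sgM rmulA.
    right; exists (madd q (mopp (lact r q))), y.
    by rewrite VD covrep_VN rmulDl rmulNr Vl rmulA.
  - move=> x /hL [[|m] [n [_ hx]]]; last first.
      by case/NF_SQ_inv: hx => q [y [_ ->]]; right; exists q, y.
    by left; case: (NF_split hx) => _ [z [/NF00_inv [r ->] [_ ->]]]; exists r, z.
  - by move=> e [he fe]; exists e. }
have [L' [hL' eL]] : exists L' : list (sQ sy * C),
    (forall c, In c L' -> exists m n, (k <= m)%nat /\ NFc m n (snd c)) /\
    (forall x, In x L -> exists c, In c L' /\ x = V (fst c) * snd c).
{ elim: L hL => [|x L IHL] hL; first by exists [].
  case: IHL => [y hy|L' [h1 h2]]; first by apply: hL; right.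
  case: (hL x) => [|[|m] [n [le_km hx]]]; [by left | lia |].
  case/NF_SQ_inv: hx => q [y [hy ->]]; exists ((q, y) :: L'); split.
    by move=> c [<-|/h1 //]; exists m, n; split; [lia|].
  move=> _ [<-|/h2 [c [hc ->]]]; first by exists (q, y); split=> //; left.
  by exists c; split=> //; right. }
case: (FS (map fst L') []) => -[Th [[l ThE] fix_q]] _.
case: (IH (flat_map (fun c => map (fun t => sg (psi sy (snd t) (fst c)) * snd c) l) L')).
  move=> x /in_flat_map [c [/hL' [m [n [le_km hc]]] /in_map_iff [t [<- _]]]].
  by exists m, n; split=> //; apply: NF_lact.
move=> a [ha fa].
exists (fold_right (fun t acc => V (fst t) * a * U (snd t) + acc) 0 l); split.
  elim: l {ThE fa} => [|t l IHl] /=; first exact: span_zero.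
  apply: span_add => //; move: a ha {IHl}.
  apply: (@span_map _ _ (fun a => V (fst t) * a * U (snd t))).
    by move=> c d; rewrite rmulDr rmulDl.
  by move=> a ha; apply: span_in; do 2!constructor.
move=> x /eL [c [hc ->]].
(* Only the [q] on the right-hand side is expanded; both sides are then sums over [l] that agree
   term by term. *)
have {2}<- : thetaQ l (fst c) = fst c by rewrite -ThE fix_q //; apply: in_map.
have {}fa : forall t, In t l -> a * (sg (psi sy (snd t) (fst c)) * snd c)
    = sg (psi sy (snd t) (fst c)) * snd c.
  move=> t ht; apply: fa; apply/in_flat_map; exists c; split=> //.
  exact: (in_map (fun t => sg (psi sy (snd t) (fst c)) * snd c)).
elim: l fa {ThE} => [|t l IHl] fa /=; first by rewrite covrep_V0 !rmul0r.
rewrite VD Vr !rmulDl IHl; first by move=> u hu; apply: fa; right.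
congr (_ + _); rewrite -!rmulA; congr (_ * _).
by move: (fa t (or_introl eq_refl)); rewrite !UV -!rmulA.
Qed.

End SUnital.
End Covrep.

(** * Right-hand versions by passage to the opposite ring *)

Section Opposite.
Variables (R : Ring) (sy : System R) (C : Ring).
Variables (U : sP sy -> C) (V : sQ sy -> C) (sg : R -> C).
Hypothesis cr : covrep U V sg.

Local Notation NFo := (@NF (opp_ring R) (opp_system sy) (opp_ring C) V U sg).

Lemma NF_opp m n x : NF U V sg m n x <-> NFo n m x.
Proof.
split; elim=> {m n x} [r|m n q x _ h|m n x p _ h].
- exact: (@NF_R _ (opp_system sy) (opp_ring C) V U sg r).
- exact: (@NF_P _ (opp_system sy) (opp_ring C) V U sg n m x q).
- exact: (@NF_Q _ (opp_system sy) (opp_ring C) V U sg n m p x).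
- exact: NF_R.
- exact: (@NF_P R sy C U V sg n m x q).
- exact: (@NF_Q R sy C U V sg n m p x).
Qed.

Hypothesis su : s_unital_system sy.

Lemma NF_right_unit (FS : condFS sy) k (L : list C) :
  (forall x, In x L -> exists m n, (k <= n)%nat /\ NF U V sg m n x) ->
  exists a, span (NF U V sg k k) a /\ forall x, In x L -> x * a = x.
Proof.
move=> hL.
have [x /hL [m [n [le_kn /NF_opp hx]]]|a [ha fa]] :=
    NF_left_unit (opp_covrep cr) (opp_s_unital su) (opp_condFS FS) (k := k) (L := L).
  by exists n, m.
exists a; split=> //; move: a ha {fa}.
apply: (@span_least (opp_ring C)); first exact: (subgroup_span (A := C)).
by move=> a /NF_opp ha; apply: span_in.
Qed.

Lemma NF_SQ_inv_right m x : NF U V sg (S m) 0 x ->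
  exists q y, NF U V sg m 0 y /\ x = y * V q.
Proof.
move/NF_opp => h.
case: (NF_SP_inv_left (opp_covrep cr) (opp_s_unital su) h) => q [y [/NF_opp hy ->]].
by exists q, y.
Qed.

(** The counterpart of [psik_prodspan]: the outer factors [U p] and [V q] are split off, the inner
    product is a value of [psik] by induction, and [p] absorbs it as [psik] prescribes. *)
Lemma NF_psik k y z : NF U V sg 0 (S k) y -> NF U V sg (S k) 0 z ->
  exists p q ps qs, length ps = k /\ length qs = k /\ y * z = sg (psik (sy := sy) p q ps qs).
Proof.
case: (cr) => [_ [_ [_ [Ur [_ [_ [Vl UV]]]]]]].
elim: k y z => [|k IH] y z /(NF_SP_inv_left cr su) [p [y' [hy ->]]]
    /NF_SQ_inv_right [q [z' [hz ->]]].
  case: (NF00_inv hy) (NF00_inv hz) => r -> [s ->].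
  exists (ract p r), (lact s q), [], []; split=> //; split=> //=.
  by rewrite UV Ur Vl.
case: (IH _ _ hy hz) => p' [q' [ps [qs [<- [Eqs E]]]]].
exists p, q, (p' :: ps), (q' :: qs); split=> //; split; first by rewrite /= Eqs.
by rewrite /= UV Ur -E !rmulA.
Qed.
End Opposite.

(** * Graded rings *)

Definition grading (A : Ring) (G : Z -> A -> Prop) :=
  (forall i, subgroup (G i)) /\
  (forall i j x y, G i x -> G j y -> G (i + j)%Z (x * y)).

Lemma Tgrad_grading (R : Ring) (sy : System R) (C : Ring)
    (U : sP sy -> C) (V : sQ sy -> C) (sg : R -> C) :
  grading (Tgrad U V sg).
Proof. by split=> [i|i j x y]; [exact: subgroup_span | exact: Tgrad_mul]. Qed.

Section Grading.
Variables (A : Ring) (G : Z -> A -> Prop).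
Hypothesis gG : grading G.

Let Gsub i : subgroup (G i). Proof. by case: gG. Qed.
Let Gmul i j k x y : G i x -> G j y -> (i + j = k)%Z -> G k (x * y).
Proof. by move=> hx hy <-; case: gG => _; apply. Qed.

Lemma prodspan_deg i j k x : (i + j = k)%Z -> prodspan (G i) (G j) x -> G k x.
Proof.
move=> E; apply: span_least => // _ [y [z [hy [hz ->]]]].
exact: Gmul hy hz E.
Qed.

Lemma prodspan_mull i j d x : G 0 d -> prodspan (G i) (G j) x -> prodspan (G i) (G j) (d * x).
Proof.
move=> hd; move: x; apply: span_map; first exact: mul_l_additive.
move=> _ [y [z [hy [hz ->]]]]; rewrite rmulA; apply: prodspan_mul => //.
exact: Gmul hd hy _.
Qed.

Lemma prodspan_mulr i j d x : G 0 d -> prodspan (G i) (G j) x -> prodspan (G i) (G j) (x * d).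
Proof.
move=> hd; move: x; apply: span_map; first exact: mul_r_additive.
move=> _ [y [z [hy [hz ->]]]]; rewrite -rmulA; apply: prodspan_mul => //.
by apply: Gmul hz hd _; lia.
Qed.

Lemma prodspan_units i :
  (forall x, prodspan (G i) (G (- i)) x -> exists a b, prodspan (G i) (G (- i)) a /\
     prodspan (G i) (G (- i)) b /\ a * x = x /\ x * b = x) ->
  forall L, (forall z, In z L -> prodspan (G i) (G (- i)) z) ->
  (exists a, prodspan (G i) (G (- i)) a /\ forall z, In z L -> a * z = z) /\
  (exists b, prodspan (G i) (G (- i)) b /\ forall z, In z L -> z * b = z).
Proof.
have deg x : prodspan (G i) (G (- i)) x -> G 0 x by apply: prodspan_deg; lia.
have sI := @subgroup_span A (fun z => exists x y, G i x /\ G (- i) y /\ z = x * y).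
move=> units L hL; split.
- apply: (@common_left_unit A (prodspan (G i) (G (- i))) (prodspan (G i) (G (- i)))) => //.
  + by move=> d e /deg; apply: prodspan_mull.
  + by move=> x /units [a [b [ha [hb [ea eb]]]]]; exists a.
  + move=> e x /deg he hx; case: sI => _ [ID IN]; apply: (ID) => //; apply: IN.
    exact: prodspan_mull.
- apply: (@common_right_unit A (prodspan (G i) (G (- i))) (prodspan (G i) (G (- i)))) => //.
  + by move=> d e /deg; apply: prodspan_mull.
  + by move=> x /units [a [b [ha [hb [ea eb]]]]]; exists b.
  + move=> e x /deg he hx; case: sI => _ [ID IN]; apply: (ID) => //; apply: IN.
    exact: prodspan_mulr.
Qed.

Section NearlyEpsilon.
Hypothesis eps : nearly_eps_strongly G.

Lemma nearly_eps_left i L : (forall x, In x L -> G i x) ->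
  exists a, prodspan (G i) (G (- i)) a /\ forall x, In x L -> a * x = x.
Proof.
apply: common_left_unit.
- exact: subgroup_span.
- by move=> d e hd; apply: prodspan_mull; apply: prodspan_deg hd; lia.
- by move=> x /eps [a [b [ha [hb [ea eb]]]]]; exists a.
- move=> e x he hx; case: (Gsub i) => _ [GD GN]; apply: (GD) => //; apply: GN.
  have h0 : G 0 e by apply: prodspan_deg he; lia.
  exact: Gmul h0 hx _.
Qed.

Lemma nearly_eps_right i L : (forall x, In x L -> G i x) ->
  exists b, prodspan (G (- i)) (G i) b /\ forall x, In x L -> x * b = x.
Proof.
apply: common_right_unit.
- exact: subgroup_span.
- by move=> d e hd; apply: prodspan_mull; apply: prodspan_deg hd; lia.
- by move=> x /eps [a [b [ha [hb [ea eb]]]]]; exists b.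
- move=> e x he hx; case: (Gsub i) => _ [GD GN]; apply: (GD) => //; apply: GN.
  have h0 : G 0 e by apply: prodspan_deg he; lia.
  by apply: Gmul hx h0 _; lia.
Qed.
End NearlyEpsilon.

(** Only one side is asked for in each degree, the one where the unit lies in $O_kO_{-k}$ with
    $k\ge0$. The unit on the other side lies in $O_{-k}O_k$ and is obtained by transfer, as that
    ideal is s-unital. *)
Lemma nearly_eps_intro :
  (forall k x, G (Z.of_nat k) x ->
     exists a, prodspan (G (Z.of_nat k)) (G (- Z.of_nat k)) a /\ a * x = x) ->
  (forall k x, G (- Z.of_nat k) x ->
     exists b, prodspan (G (Z.of_nat k)) (G (- Z.of_nat k)) b /\ x * b = x) ->
  (forall k, s_unital_ideal (prodspan (G (- Z.of_nat k)) (G (Z.of_nat k)))) ->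
  nearly_eps_strongly G.
Proof.
move=> hl hr hI i x.
have units k : forall L, (forall z, In z L -> prodspan (G (- Z.of_nat k)) (G (Z.of_nat k)) z) ->
  (exists a, prodspan (G (- Z.of_nat k)) (G (Z.of_nat k)) a /\ forall z, In z L -> a * z = z) /\
  (exists b, prodspan (G (- Z.of_nat k)) (G (Z.of_nat k)) b /\ forall z, In z L -> z * b = z).
  rewrite -{2 4 6}(Z.opp_involutive (Z.of_nat k)).
  by apply: prodspan_units => y; rewrite Z.opp_involutive; exact: hI.
case: (Z.le_ge_cases 0 i) => le0i.
- rewrite -(Z2Nat.id i) //; move: (Z.to_nat i) => k hx.
  case: (hl k x hx) => a [ha ea].
  have [L hL|b [hb eb]] := transfer_right_unit _ hx ha ea.
    by case: (units k L hL).
  by exists a, b.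
- have -> : i = (- Z.of_nat (Z.to_nat (- i)))%Z by lia.
  move: (Z.to_nat (- i)) => k hx; rewrite Z.opp_involutive.
  case: (hr k x hx) => b [hb eb].
  have [L hL|a [ha ea]] := transfer_left_unit _ hx hb eb.
    by case: (units k L hL).
  by exists a, b.
Qed.
End Grading.

(** * Semi-full representations that are nearly epsilon-strongly graded *)

Section CovrepNearlyEpsilon.
Variables (R : Ring) (sy : System R) (C : Ring).
Variables (U : sP sy -> C) (V : sQ sy -> C) (sg : R -> C).
Hypotheses (cr : covrep U V sg) (su : s_unital_system sy) (FS : condFS sy).

Lemma covrep_nearly_eps :
  semi_full sy sg (Tgrad U V sg) ->
  (forall k, s_unital_ideal (Ik sy sg (Tgrad U V sg) k)) ->
  nearly_eps_strongly (Tgrad U V sg).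
Proof.
move=> full sI.
have NFdeg k a : span (NF U V sg k k) a ->
    prodspan (Tgrad U V sg (Z.of_nat k)) (Tgrad U V sg (- Z.of_nat k)) a.
  apply: span_least; [exact: subgroup_span | exact: NF_prodspan].
apply: nearly_eps_intro; first exact: Tgrad_grading.
- move=> k x /(Tgrad_NF cr su) /span_fix [L [hL fL]].
  case: (NF_left_unit cr su FS (k := k) (L := L)) => [y /hL [m [n [E hy]]]|a [ha fa]].
    by exists m, n; split=> //; lia.
  by exists a; split; [exact: NFdeg | exact: fL].
- move=> k x /(Tgrad_NF cr su) /span_fix_right [L [hL fL]].
  case: (NF_right_unit cr su FS (k := k) (L := L)) => [y /hL [m [n [E hy]]]|a [ha fa]].
    by exists m, n; split=> //; lia.
  by exists a; split; [exact: NFdeg | exact: fL].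
- move=> k x /full /sI [a [b [ha [hb e]]]]; exists a, b.
  by rewrite !(full k).
Qed.
End CovrepNearlyEpsilon.

(** * Quotients and the Toeplitz ring *)

Section QuotientRing.
Variables (X : Type) (e : X -> X -> Prop).
Variables (z0 : X) (ad : X -> X -> X) (op : X -> X) (mu : X -> X -> X).
Hypotheses (e_refl : forall x, e x x) (e_sym : forall x y, e x y -> e y x)
  (e_trans : forall x y z, e x y -> e y z -> e x z)
  (adE : forall x x' y y', e x x' -> e y y' -> e (ad x y) (ad x' y'))
  (opE : forall x x', e x x' -> e (op x) (op x'))
  (muE : forall x x' y y', e x x' -> e y y' -> e (mu x y) (mu x' y'))
  (adA : forall x y z, e (ad x (ad y z)) (ad (ad x y) z))
  (adC : forall x y, e (ad x y) (ad y x))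
  (ad0 : forall x, e (ad z0 x) x)
  (adN : forall x, e (ad (op x) x) z0)
  (muA : forall x y z, e (mu x (mu y z)) (mu (mu x y) z))
  (muDl : forall x y z, e (mu (ad x y) z) (ad (mu x z) (mu y z)))
  (muDr : forall x y z, e (mu x (ad y z)) (ad (mu x y) (mu x z))).

(** The laws of [Ring] are Leibniz equalities, so a class is the predicate [e x] itself. The carrier
    [X] is a bare type with laws up to [e], which covers both cosets of an ideal and formal
    terms. *)
Definition quot_car := {P : X -> Prop | exists x, P = e x}.

Definition quot_class (x : X) : quot_car := exist _ (e x) (ex_intro _ x eq_refl).

Definition quot_repr (c : quot_car) : X :=
  proj1_sig (constructive_indefinite_description _ (proj2_sig c)).

Lemma quot_class_eq x y : quot_class x = quot_class y <-> e x y.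
Proof.
split=> [E|exy].
  have : e x = e y by exact: (f_equal (@proj1_sig _ _) E).
  by move=> ->.
apply: eq_sig_hprop; first by move=> P; exact: proof_irrelevance.
apply: functional_extensionality => z; apply: propositional_extensionality.
by split=> h; [apply: e_trans (e_sym exy) h | apply: e_trans exy h].
Qed.

Lemma quot_reprK c : quot_class (quot_repr c) = c.
Proof.
apply: eq_sig_hprop; first by move=> P; exact: proof_irrelevance.
by rewrite /quot_repr; case: constructive_indefinite_description => x.
Qed.

Lemma quot_class_surj c : exists x, c = quot_class x.
Proof. by exists (quot_repr c); rewrite quot_reprK. Qed.

Lemma quot_repr_class x : e (quot_repr (quot_class x)) x.
Proof. by apply/quot_class_eq; rewrite quot_reprK. Qed.

Definition quot_add c d := quot_class (ad (quot_repr c) (quot_repr d)).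
Definition quot_opp c := quot_class (op (quot_repr c)).
Definition quot_mul c d := quot_class (mu (quot_repr c) (quot_repr d)).

Lemma quot_addE x y : quot_add (quot_class x) (quot_class y) = quot_class (ad x y).
Proof. by apply/quot_class_eq; apply: adE; exact: quot_repr_class. Qed.
Lemma quot_oppE x : quot_opp (quot_class x) = quot_class (op x).
Proof. by apply/quot_class_eq; apply: opE; exact: quot_repr_class. Qed.
Lemma quot_mulE x y : quot_mul (quot_class x) (quot_class y) = quot_class (mu x y).
Proof. by apply/quot_class_eq; apply: muE; exact: quot_repr_class. Qed.

Definition quot_ring : Ring.
refine (@Build_Ring quot_car (quot_class z0) quot_add quot_opp quot_mul _ _ _ _ _ _ _);
  repeat (let c := fresh in move=> c; case: (quot_class_surj c) => ? -> {c});
  rewrite ?(quot_addE, quot_oppE, quot_mulE); apply/quot_class_eq.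
- exact: adA.
- exact: adC.
- exact: ad0.
- exact: adN.
- exact: muA.
- exact: muDl.
- exact: muDr.
Defined.

Definition quot_map : X -> quot_ring := quot_class.

Lemma quot_mapD x y : quot_map (ad x y) = quot_map x + quot_map y.
Proof. by rewrite /= quot_addE. Qed.
Lemma quot_mapN x : quot_map (op x) = - quot_map x.
Proof. by rewrite /= quot_oppE. Qed.
Lemma quot_mapM x y : quot_map (mu x y) = quot_map x * quot_map y.
Proof. by rewrite /= quot_mulE. Qed.
End QuotientRing.

Lemma ideal_quotient (A : Ring) (I : A -> Prop) : is_ideal I ->
  exists (Q : Ring) (f : A -> Q), ringhom f /\ (forall c, exists x, f x = c) /\
    forall x, f x = 0 <-> I x.
Proof.
move=> [I0 [ID [IN [Il Ir]]]].
pose e (x y : A) := I (x - y).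
have e_refl x : e x x by rewrite /e raddrN.
have e_sym x y : e x y -> e y x by rewrite /e => /IN; rewrite roppD roppK raddC.
have e_trans x y z : e x y -> e y z -> e x z.
  move=> h1 h2; have := ID _ _ h1 h2.
  by rewrite -raddA (raddA (- y)) raddN radd0.
have adE x x' y y' : e x x' -> e y y' -> e (x + y) (x' + y').
  by move=> h1 h2; rewrite /e roppD raddACA; exact: ID.
have opE x x' : e x x' -> e (- x) (- x') by rewrite /e -roppD; exact: IN.
have muE x x' y y' : e x x' -> e y y' -> e (x * y) (x' * y').
  move=> h1 h2; apply: (e_trans _ (x' * y)).
    by rewrite /e -rmulNr -rmulDl; exact: Ir.
  by rewrite /e -rmulrN -rmulDr; exact: Il.
have eqe x y : x = y -> e x y by move=> ->.
exists (@quot_ring A e 0 radd ropp rmul e_refl e_sym e_trans adE opE muE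
  (fun x y z => eqe _ _ (raddA x y z)) (fun x y => eqe _ _ (raddC x y))
  (fun x => eqe _ _ (radd0 x)) (fun x => eqe _ _ (raddN x))
  (fun x y z => eqe _ _ (rmulA x y z)) (fun x y z => eqe _ _ (rmulDl x y z))
  (fun x y z => eqe _ _ (rmulDr x y z))).
exists (@quot_map _ _ _ _ _ _ _ _ _ _ _ _ _ _ _ _ _ _ _); split; [split|split].
- by move=> x y; rewrite quot_mapD.
- by move=> x y; rewrite quot_mapM.
- by move=> c; case: (quot_class_surj c) => x ->; exists x.
- move=> x; apply: (iff_trans (quot_class_eq e_refl e_sym e_trans _ _)).
  by rewrite /e ropp0 raddr0.
Qed.

Section Toeplitz.
Variables (R : Ring) (sy : System R).

Inductive term :=
| t_zero | t_add (s t : term) | t_opp (s : term) | t_mul (s t : term) | t_gen (g : gen sy).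

Local Notation tP p := (t_gen (gP p)).
Local Notation tQ q := (t_gen (gQ q)).
Local Notation tR r := (t_gen (gR r)).

(** The Toeplitz ring is specified by a universal property only; it is realized by generators and
    relations. This is the least congruence that imposes the ring laws and the covariance
    relations. *)
Inductive teq : term -> term -> Prop :=
| teq_refl x : teq x x
| teq_sym x y : teq x y -> teq y x
| teq_trans x y z : teq x y -> teq y z -> teq x z
| teq_add x x' y y' : teq x x' -> teq y y' -> teq (t_add x y) (t_add x' y')
| teq_opp x x' : teq x x' -> teq (t_opp x) (t_opp x')
| teq_mul x x' y y' : teq x x' -> teq y y' -> teq (t_mul x y) (t_mul x' y')
| teq_addA x y z : teq (t_add x (t_add y z)) (t_add (t_add x y) z)
| teq_addC x y : teq (t_add x y) (t_add y x)
| teq_add0 x : teq (t_add t_zero x) x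
| teq_addN x : teq (t_add (t_opp x) x) t_zero
| teq_mulA x y z : teq (t_mul x (t_mul y z)) (t_mul (t_mul x y) z)
| teq_mulDl x y z : teq (t_mul (t_add x y) z) (t_add (t_mul x z) (t_mul y z))
| teq_mulDr x y z : teq (t_mul x (t_add y z)) (t_add (t_mul x y) (t_mul x z))
| teq_PD p p' : teq (tP (madd p p')) (t_add (tP p) (tP p'))
| teq_QD q q' : teq (tQ (madd q q')) (t_add (tQ q) (tQ q'))
| teq_RD r r' : teq (tR (r + r')) (t_add (tR r) (tR r'))
| teq_RM r r' : teq (tR (r * r')) (t_mul (tR r) (tR r'))
| teq_Pr p r : teq (tP (ract p r)) (t_mul (tP p) (tR r))
| teq_Pl r p : teq (tP (lact r p)) (t_mul (tR r) (tP p))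
| teq_Qr q r : teq (tQ (ract q r)) (t_mul (tQ q) (tR r))
| teq_Ql r q : teq (tQ (lact r q)) (t_mul (tR r) (tQ q))
| teq_PQ p q : teq (tR (psi sy p q)) (t_mul (tP p) (tQ q)).

Definition toeplitz_ring : Ring :=
  quot_ring teq_refl teq_sym teq_trans teq_add teq_opp teq_mul
    teq_addA teq_addC teq_add0 teq_addN teq_mulA teq_mulDl teq_mulDr.

Definition toeplitz_map : term -> toeplitz_ring := @quot_map _ _ _ _ _ _ _ _ _ _ _ _ _ _ _ _ _ _ _.

Fixpoint teval (C : Ring) (U : sP sy -> C) (V : sQ sy -> C) (sg : R -> C) (t : term) : C :=
  match t with
  | t_zero => 0
  | t_add s t => teval U V sg s + teval U V sg t
  | t_opp s => - teval U V sg s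
  | t_mul s t => teval U V sg s * teval U V sg t
  | t_gen g => gval U V sg g
  end.

Lemma teval_teq (C : Ring) (U : sP sy -> C) (V : sQ sy -> C) (sg : R -> C) x y :
  covrep U V sg -> teq x y -> teval U V sg x = teval U V sg y.
Proof.
move=> [UD [VD [[sD sM] [Ur [Ul [Vr [Vl UV]]]]]]].
elim=> {x y} //=; try congruence.
- by move=> *; rewrite raddA.
- by move=> *; rewrite raddC.
- by move=> *; rewrite radd0.
- by move=> *; rewrite raddN.
- by move=> *; rewrite rmulA.
- by move=> *; rewrite rmulDl.
- by move=> *; rewrite rmulDr.
Qed.

Lemma toeplitz_exists : exists (B : Ring) (U : sP sy -> B) (V : sQ sy -> B) (sg : R -> B),
  is_toeplitz U V sg.
Proof.
have teqE x y : toeplitz_map x = toeplitz_map y <-> teq x y.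
  exact: (quot_class_eq teq_refl teq_sym teq_trans).
have mD x y : toeplitz_map (t_add x y) = toeplitz_map x + toeplitz_map y by exact: quot_mapD.
have mM x y : toeplitz_map (t_mul x y) = toeplitz_map x * toeplitz_map y by exact: quot_mapM.
have mN x : toeplitz_map (t_opp x) = - toeplitz_map x by exact: quot_mapN.
have m_surj c : exists x, c = toeplitz_map x by exact: quot_class_surj.
exists toeplitz_ring, (fun p => toeplitz_map (tP p)), (fun q => toeplitz_map (tQ q)),
  (fun r => toeplitz_map (tR r)); split.
  do !split; move=> *; rewrite -?mD -?mM; apply/teqE; first
    [ exact: teq_PD | exact: teq_QD | exact: teq_RD | exact: teq_RM | exact: teq_Pr
    | exact: teq_Pl | exact: teq_Qr | exact: teq_Ql | exact: teq_PQ ].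
move=> C U V sg cr; split.
- pose eta (c : toeplitz_ring) := teval U V sg (quot_repr c).
  have etaE t : eta (toeplitz_map t) = teval U V sg t.
    apply: teval_teq => //.
    exact: (quot_repr_class teq_refl teq_sym teq_trans).
  exists eta; split; last by do !split; move=> ?; rewrite etaE.
  split=> x y; case: (m_surj x) => {}x ->; case: (m_surj y) => {}y ->.
    by rewrite -mD !etaE.
  by rewrite -mM !etaE.
- move=> e1 e2 [[e1D e1M] [e1P [e1Q e1R]]] [[e2D e2M] [e2P [e2Q e2R]]] c.
  case: (m_surj c) => t ->; elim: t => {c} [|s IHs t IHt|s IHs|s IHs t IHt|[r|p|q]].
  + by rewrite (additive0 e1D) (additive0 e2D).
  + by rewrite mD e1D e2D IHs IHt.
  + by rewrite mN (additiveN e1D) (additiveN e2D) IHs.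
  + by rewrite mM e1M e2M IHs IHt.
  + by rewrite e1R e2R.
  + by rewrite e1P e2P.
  + by rewrite e1Q e2Q.
Qed.
End Toeplitz.

(** * Additive endomorphisms of the group of functions on the integers *)

Section EndoRing.
Variable A : Ring.

Local Notation M := (Z -> A).
Local Notation addM g h := (fun n : Z => g n + h n).
Local Notation E := {f : M -> M | forall g h, f (addM g h) = addM (f g) (f h)}.

Lemma endo_eq (f f' : E) :
  (forall g n, proj1_sig f g n = proj1_sig f' g n) -> f = f'.
Proof.
move=> h; apply: eq_sig_hprop; first by move=> ?; exact: proof_irrelevance.
by do 2!apply: functional_extensionality => ?.
Qed.

Definition endo_ring : Ring.
unshelve refine (@Build_Ring E
  (exist _ (fun _ _ => 0) _)
  (fun f f' => exist _ (fun g => addM (proj1_sig f g) (proj1_sig f' g)) _)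
  (fun f => exist _ (fun g n => - proj1_sig f g n) _)
  (fun f f' => exist _ (fun g => proj1_sig f (proj1_sig f' g)) _) _ _ _ _ _ _ _).
- by move=> g h; apply: functional_extensionality => n; rewrite radd0.
- case: f => f /= hf; case: f' => f' /= hf' g h.
  by apply: functional_extensionality => n; rewrite hf hf' raddACA.
- case: f => f /= hf g h.
  by apply: functional_extensionality => n; rewrite hf roppD.
- by case: f => f /= hf; case: f' => f' /= hf' g h; rewrite hf' hf.
- by move=> x y z; apply: endo_eq => g n /=; rewrite raddA.
- by move=> x y; apply: endo_eq => g n /=; rewrite raddC.
- by move=> x; apply: endo_eq => g n /=; rewrite radd0.
- by move=> x; apply: endo_eq => g n /=; rewrite raddN.
- by move=> x y z; apply: endo_eq.
- by move=> x y z; apply: endo_eq.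
- by move=> [x hx] y z; apply: endo_eq => g n /=; rewrite hx.
Defined.
End EndoRing.

(** * Generation and independence of the homogeneous components *)

Section SubRing.
Variables (A : Ring) (H : A -> Prop).
Hypotheses (sH : subgroup H) (mH : forall x y, H x -> H y -> H (x * y)).

Local Notation E := {x : A | H x}.

Lemma sub_val_inj (x y : E) : proj1_sig x = proj1_sig y -> x = y.
Proof. by move=> e; apply: eq_sig_hprop => // ?; exact: proof_irrelevance. Qed.

Definition sub_ring : Ring.
refine (@Build_Ring E (exist _ 0 (proj1 sH))
  (fun x y => exist _ (proj1_sig x + proj1_sig y)
     (proj1 (proj2 sH) _ _ (proj2_sig x) (proj2_sig y)))
  (fun x => exist _ (- proj1_sig x) (proj2 (proj2 sH) _ (proj2_sig x)))
  (fun x y => exist _ (proj1_sig x * proj1_sig y) (mH (proj2_sig x) (proj2_sig y)))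
  _ _ _ _ _ _ _); move=> *; apply: sub_val_inj => /=.
- exact: raddA.
- exact: raddC.
- exact: radd0.
- exact: raddN.
- exact: rmulA.
- exact: rmulDl.
- exact: rmulDr.
Defined.

Definition sub_val (x : sub_ring) : A := proj1_sig (x : E).
End SubRing.

(** The sums of homogeneous elements form a subring containing the representation, so the universal
    map factors through it. Followed by the inclusion it must be the identity, by uniqueness. *)
Lemma toeplitz_span (R : Ring) (sy : System R) (B : Ring)
    (U : sP sy -> B) (V : sQ sy -> B) (sg : R -> B) (x : B) :
  is_toeplitz U V sg -> span (fun y => exists i, Tgrad U V sg i y) x.
Proof.
move=> [cr univ].
pose H := span (fun y : B => exists i, Tgrad U V sg i y).
have mH (y z : B) : H y -> H z -> H (y * z).
  apply: span_mul_least; first exact: subgroup_span.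
  move=> {}y {}z [i hy] [j hz]; apply: span_in; exists (i + j)%Z.
  exact: Tgrad_mul.
pose H' := sub_ring (subgroup_span _) mH.
have hU p : H (U p) by apply: span_in; exists (-1)%Z; exact: Tgrad_P.
have hV q : H (V q) by apply: span_in; exists 1%Z; exact: Tgrad_Q.
have hs r : H (sg r) by apply: span_in; exists 0%Z; exact: Tgrad_R.
have cr' : @covrep R sy H' (fun p => exist _ (U p) (hU p))
    (fun q => exist _ (V q) (hV q)) (fun r => exist _ (sg r) (hs r)).
  case: cr => [UD [VD [[sD sM] [Ur [Ul [Vr [Vl UV]]]]]]].
  by do !split; move=> *; apply: sub_val_inj => /=.
have [[eta [[etaD etaM] [etaU [etaV etas]]]] _] := univ _ _ _ _ cr'.
have [_ uniq] := univ _ _ _ _ cr.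
have <- : sub_val (eta x) = x.
  apply: (uniq (fun x => sub_val (eta x)) (fun x => x)); last by do !split.
  do !split; move=> *; by rewrite ?etaD ?etaM ?etaU ?etaV ?etas.
exact: proj2_sig.
Qed.

(** A decomposition into components is a function on all of [Z] with one bound for both signs, so
    that decompositions are added pointwise once their bounds are made equal. *)
Fixpoint symsum (A : Ring) (N : nat) (f : Z -> A) : A :=
  match N with
  | O => f 0%Z
  | S n => symsum n f + (f (Z.of_nat N) + f (- Z.of_nat N)%Z)
  end.

Lemma symsumS (A : Ring) n (f : Z -> A) :
  symsum (S n) f = symsum n f + (f (Z.of_nat (S n)) + f (- Z.of_nat (S n))%Z).
Proof. by []. Qed.

Lemma symsum_morph (A B : Ring) (h : A -> B) N f :
  additive h -> h (symsum N f) = symsum N (fun i => h (f i)).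
Proof. by move=> hD; elim: N => [|n IH] //=; rewrite !hD IH. Qed.

Lemma symsum_add (A : Ring) N (f g : Z -> A) :
  symsum N f + symsum N g = symsum N (fun i => f i + g i).
Proof.
by elim: N => [|n IH] //=; rewrite -IH raddACA; congr (_ + _); rewrite raddACA.
Qed.

Lemma symsum_widen (A : Ring) N M (f : Z -> A) : (N <= M)%nat ->
  (forall i, (Z.of_nat N < Z.abs i)%Z -> f i = 0) -> symsum M f = symsum N f.
Proof.
move=> le_NM f0; elim: M le_NM => [|M IH] le_NM.
  by have -> : N = 0%nat by lia.
case: (Nat.eq_dec N (S M)) => [->//|ne_NM].
by rewrite -IH /=; [lia | rewrite !f0 ?radd0 ?raddr0 //; lia].
Qed.

Lemma symsum_single (A : Ring) N j (f : Z -> A) : (Z.abs j <= Z.of_nat N)%Z ->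
  (forall i, i <> j -> f i = 0) -> symsum N f = f j.
Proof.
move=> le_jN f0; case: (Z.eq_dec j 0) => [E|nz].
  rewrite E; apply: (@symsum_widen _ 0%nat) => [|i hi]; first lia.
  by apply: f0; lia.
have E : exists n, Z.abs j = Z.of_nat (S n) by exists (Nat.pred (Z.abs_nat j)); lia.
case: E => n E.
rewrite (@symsum_widen _ (S n)); [lia | by move=> i hi; apply: f0; lia |].
rewrite symsumS; have -> : symsum n f = 0.
  have : (Z.of_nat n < Z.abs j)%Z by lia.
  elim: {E} n => [|n IH] lt_nj; first by apply: f0; lia.
  rewrite symsumS.
  have -> : f (Z.of_nat (S n)) = 0 by apply: f0; lia.
  have -> : f (- Z.of_nat (S n))%Z = 0 by apply: f0; lia.
  by rewrite IH; [lia | rewrite !radd0].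
rewrite radd0; case: (Z.abs_eq_or_opp j) => Ej.
  by rewrite -E Ej (f0 (- j)%Z) ?raddr0 //; lia.
by rewrite -E Ej Z.opp_involutive (f0 (- j)%Z) ?radd0 //; lia.
Qed.

Lemma span_symsum (A : Ring) (G : Z -> A -> Prop) x :
  (forall i, subgroup (G i)) -> span (fun y => exists i, G i y) x ->
  exists N f, (forall i, G i (f i)) /\ x = symsum N f.
Proof.
move=> sG hx.
(* Vanishing beyond the bound is added to the claim so that two sums can be widened to the larger of
   their bounds. *)
suff [N [f [fG [_ ->]]]] : exists N f, (forall i, G i (f i)) /\
    (forall i, (Z.of_nat N < Z.abs i)%Z -> f i = 0) /\ x = symsum N f by exists N, f.
elim: hx => {x} [x [j hx]||x y _ [N [f [fG [f0 ->]]]] _ [M [g [gG [g0 ->]]]]|x _ [N [f [fG [f0 ->]]]]].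
- exists (Z.abs_nat j), (fun i => if (i =? j)%Z then x else 0); split; [|split].
  + by move=> i; case: Z.eqb_spec => [->|_] //; case: (sG i).
  + by move=> i hi; case: Z.eqb_spec => // E; lia.
  + rewrite (@symsum_single _ _ j); [lia | by move=> i; case: Z.eqb_spec |].
    by case: Z.eqb_spec.
- exists 0%nat, (fun _ => 0); split=> // i; by case: (sG i).
- exists (Nat.max N M), (fun i => f i + g i); split; [|split].
  + by move=> i; case: (sG i) => _ [GD _]; apply: GD.
  + by move=> i hi; rewrite f0 ?g0 ?radd0 //; lia.
  + by rewrite -symsum_add (symsum_widen _ f0) ?(symsum_widen _ g0) //; lia.
- exists N, (fun i => - f i); split; [|split].
  + by move=> i; case: (sG i) => _ [_ GN]; apply: GN.
  + by move=> i hi; rewrite f0 // ropp0.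
  + by rewrite (symsum_morph (h := @ropp A)) // => y z; rewrite roppD.
Qed.

Lemma covrep_comp (R : Ring) (sy : System R) (B C : Ring)
    (U : sP sy -> B) (V : sQ sy -> B) (sg : R -> B) (f : B -> C) :
  ringhom f -> covrep U V sg ->
  covrep (fun p => f (U p)) (fun q => f (V q)) (fun r => f (sg r)).
Proof.
move=> [fD fM] [UD [VD [[sD sM] [Ur [Ul [Vr [Vl UV]]]]]]].
by do !split; move=> *; rewrite -?fD -?fM; congr (f _).
Qed.

(** Lets the results on arbitrary covariant representations be applied to the quotient directly; an
    equality of families, so that it can be used to rewrite. *)
Lemma Ograd_comp (R : Ring) (sy : System R) (B C : Ring)
    (U : sP sy -> B) (V : sQ sy -> B) (sg : R -> B) (f : B -> C) : ringhom f ->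
  Ograd U V sg f = Tgrad (fun p => f (U p)) (fun q => f (V q)) (fun r => f (sg r)).
Proof.
move=> [fD fM].
have fg g : f (gval U V sg g) =
    gval (fun p => f (U p)) (fun q => f (V q)) (fun r => f (sg r)) g by case: g.
have fw g l : f (prodl (gval U V sg g) (map (gval U V sg) l)) =
    prodl (gval (fun p => f (U p)) (fun q => f (V q)) (fun r => f (sg r)) g)
      (map (gval (fun p => f (U p)) (fun q => f (V q)) (fun r => f (sg r))) l).
  by elim: l g => [|h l IH] g /=; rewrite ?fM fg ?IH.
apply: functional_extensionality => i; apply: functional_extensionality => y.
apply: propositional_extensionality; split.
- move=> [x [hx ->]]; move: x hx; apply: span_map => //.
  by move=> _ [g [l [E ->]]]; apply: span_in; exists g, l; rewrite fw.
- move: y; apply: span_least.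
    split; first by exists 0; rewrite (additive0 fD); split=> //; exact: span_zero.
    split=> [_ _ [x [hx ->]] [y [hy ->]]|_ [x [hx ->]]].
      by exists (x + y); split; [exact: span_add | rewrite fD].
    by exists (- x); split; [exact: span_opp | rewrite (additiveN fD)].
  move=> _ [g [l [E ->]]]; rewrite -fw.
  by eexists; split; last reflexivity; apply: span_in; exists g, l.
Qed.

Lemma ringhom_piSum (R : Ring) (sy : System R) (B C : Ring)
    (U : sP sy -> B) (V : sQ sy -> B) (f : B -> C) l : ringhom f ->
  f (piSum U V l) = piSum (fun p => f (U p)) (fun q => f (V q)) l.
Proof.
by move=> [fD fM]; elim: l => [|t l IH] /=; rewrite ?(additive0 fD) // fD fM IH.
Qed.

(* Left multiplication by a homogeneous element of degree [i], followed by a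
   shift by [i], makes the functions [Z -> O] a module on which the degree is
   visible: this separates the homogeneous components. *)
Lemma CP_independent (R : Ring) (sy : System R) (B O : Ring)
    (U : sP sy -> B) (V : sQ sy -> B) (sg : R -> B) (rho : B -> O) :
  is_CP_ring U V sg rho -> nearly_eps_strongly (Ograd U V sg rho) ->
  forall N f, (forall i, Ograd U V sg rho i (f i)) -> symsum N f = 0 ->
  forall i, (Z.abs i <= Z.of_nat N)%Z -> f i = 0.
Proof.
move=> [_ [[cr univ] [J [_ [hrho [_ ker_rho]]]]]] eps N f fG f0 j le_jN.
have [rD rM] := hrho.
have shiftE (a : O) (i : Z) : forall g h : Z -> O,
    (fun n => a * (g (n - i)%Z + h (n - i)%Z)) =
    (fun n => a * g (n - i)%Z + a * h (n - i)%Z).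
  by move=> g h; apply: functional_extensionality => n; rewrite rmulDr.
pose sh (i : Z) (a : O) : endo_ring O :=
  exist _ (fun g n => a * g (n - i)%Z) (shiftE a i).
have shD i : additive (sh i).
  by move=> a b; apply: endo_eq => g n /=; rewrite rmulDl.
have shM i i' k a b : (i + i' = k)%Z -> sh i a * sh i' b = sh k (a * b).
  move=> <-; apply: endo_eq => g n /=; rewrite rmulA; congr (_ * g _); lia.
have cr' : covrep (fun p => sh (-1)%Z (rho (U p))) (fun q => sh 1%Z (rho (V q)))
    (fun r => sh 0%Z (rho (sg r))).
  case: (cr) => [UD [VD [[sD sM] [Ur [Ul [Vr [Vl UV]]]]]]].
  do !split; move=> *; rewrite -?shD ?(shM _ _ _ _ _ eq_refl) -?rD -?rM;
    by congr (sh _ (rho _)).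
have [[eta [heta [etaU [etaV etas]]]] _] := univ _ _ _ _ cr'.
have [eD eM] := heta.
have etaE i x : Tgrad U V sg i x -> eta x = sh i (rho x).
{ move: i x; apply: Tgrad_least => [i|g|g i x hx].
  -  split; first by rewrite (additive0 eD) (additive0 rD) (additive0 (shD i)).
    split=> [x y hx hy|x hx]; first by rewrite eD rD shD hx hy.
    by rewrite (additiveN eD) (additiveN rD) (additiveN (shD i)) hx.
  - by case: g.
  - rewrite eM rM hx -(shM _ _ _ _ _ eq_refl); congr (_ * _).
    by case: g. }
(* A generator of T(J) has degree 0 and is killed by [rho], and in a fixed degree [eta] depends only
   on [rho]. So [eta] carries the relations of the quotient. *)
have eta_ker x : TJ U V sg J x -> eta x = 0.
{ have he0 i : sh i 0 = 0 by exact: additive0 (shD i).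
  elim=> {x} [y gy||x y _ hx _ hy|x _ hx|b x _ _ hx|b x _ _ hx].
  - have : rho y = 0 by apply/ker_rho; exact: ig_in.
    case: gy => x [l [_ [_ ->]]] ry; rewrite (etaE 0%Z) ?ry //.
    case: (Tgrad_grading U V sg) => G _; case: (G 0%Z) => G0 [GD GN].
    apply: (GD); first exact: Tgrad_R.
    apply: (GN); elim: l {ry} => [|t l IH] //=; apply: (GD) => //.
    exact: (Tgrad_mul (Tgrad_Q U V sg (fst t)) (Tgrad_P U V sg (snd t))).
  - exact: additive0 eD.
  - by rewrite eD hx hy radd0.
  - by rewrite (additiveN eD) hx ropp0.
  - by rewrite eM hx rmulr0.
  - by rewrite eM hx rmul0r. }
have [b bE] : exists b : Z -> B, forall i, Tgrad U V sg i (b i) /\ f i = rho (b i).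
  exists (fun i => proj1_sig (constructive_indefinite_description _ (fG i))).
  by move=> i; case: constructive_indefinite_description.
(* With [g] equal to [u] at 0 and zero elsewhere, the summand of degree [i] has value
   [f i * g (j - i)] at [j]. Only [i = j] survives, and it gives [f j * u = f j]: the right local
   unit replaces 1. *)
have [_ [u [_ [_ [_ fu]]]]] := eps _ _ (fG j).
pose g n := if (n =? 0)%Z then u else 0.
have ev : additive (fun e : endo_ring O => proj1_sig e g j) by [].
have : proj1_sig (eta (symsum N b)) g j = 0.
  rewrite eta_ker //; apply/ker_rho; rewrite (symsum_morph _ _ rD) -f0.
  by congr symsum; apply: functional_extensionality => i; case: (bE i).
rewrite (symsum_morph _ _ eD) (symsum_morph _ _ ev) (@symsum_single _ _ j) //.
  move=> i ne_ij; case: (bE i) => hb _; rewrite (etaE _ _ hb) /= /g.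
  by case: Z.eqb_spec => [E|_]; [lia | rewrite rmulr0].
case: (bE j) => hb fE; rewrite (etaE _ _ hb) /= /g -fE Z.sub_diag.
by case: Z.eqb_spec => // _; rewrite fu.
Qed.

(** [piSum] depends on the chosen list, not on the operator; this identity links the two. *)
Lemma piSum_thetaQ (R : Ring) (sy : System R) (C : Ring)
    (U : sP sy -> C) (V : sQ sy -> C) (sg : R -> C) l q : covrep U V sg ->
  V (thetaQ l q) = piSum U V l * V q.
Proof.
move=> cr; case: (cr) => [UD [VD [_ [_ [_ [Vr [_ UV]]]]]]].
elim: l => [|t l IH] /=; first by rewrite (covrep_V0 cr) rmul0r.
by rewrite VD Vr UV IH rmulDl rmulA.
Qed.

(** The pairs are swapped because [thetaP] takes the element of [P] first. *)
Lemma piSum_thetaP (R : Ring) (sy : System R) (C : Ring)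
    (U : sP sy -> C) (V : sQ sy -> C) (sg : R -> C) l p : covrep U V sg ->
  U (thetaP (map (fun t => (snd t, fst t)) l) p) = U p * piSum U V l.
Proof.
move=> cr; case: (cr) => [UD [VD [_ [_ [Ul [_ [_ UV]]]]]]].
elim: l => [|t l IH] /=.
  by rewrite rmulr0; apply: (@raddI _ (U mzero)); rewrite -UD madd0 raddr0.
by rewrite UD Ul UV IH rmulDr rmulA.
Qed.

Lemma piSum_mull (R : Ring) (sy : System R) (C : Ring)
    (U : sP sy -> C) (V : sQ sy -> C) l (x : C) :
  (forall p, U p * x = 0) -> piSum U V l * x = 0.
Proof.
move=> Ux; elim: l => [|t l IH] /=; first by rewrite rmul0r.
by rewrite rmulDl IH -rmulA Ux rmulr0 radd0.
Qed.

Lemma piSum_mulr (R : Ring) (sy : System R) (C : Ring)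
    (U : sP sy -> C) (V : sQ sy -> C) l (x : C) :
  (forall q, x * V q = 0) -> x * piSum U V l = 0.
Proof.
move=> xV; elim: l => [|t l IH] /=; first by rewrite rmulr0.
by rewrite rmulDr IH rmulA xV rmul0r radd0.
Qed.

Lemma prodspan_fix_left (A : Ring) (X Y : A -> Prop) x : prodspan X Y x ->
  exists L, (forall u, In u L -> X u) /\
    forall a, (forall u, In u L -> a * u = u) -> a * x = x.
Proof.
elim=> {x} [_ [u [v [hu [hv ->]]]]||x y _ [L1 [h1 f1]] _ [L2 [h2 f2]]|x _ [L [hL fL]]].
- exists [u]; split; first by move=> _ [<-|[]].
  by move=> a fa; rewrite rmulA fa //; left.
- by exists []; split=> // a _; rewrite rmulr0.
- exists (L1 ++ L2); split; first by move=> z /in_app_iff [/h1|/h2].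
  move=> a fa; rewrite rmulDr f1 ?f2 // => z hz; apply: fa; apply/in_app_iff; tauto.
- by exists L; split=> // a fa; rewrite rmulrN fL.
Qed.

Lemma prodspan_fix_right (A : Ring) (X Y : A -> Prop) x : prodspan X Y x ->
  exists L, (forall v, In v L -> Y v) /\
    forall a, (forall v, In v L -> v * a = v) -> x * a = x.
Proof. by move=> hx; apply: (@prodspan_fix_left (opp_ring A) Y X); apply/prodspan_opp. Qed.

(** The left factors of [x] lie in $G_i$ and the right ones in $G_{-i}$; their units on the outer
    sides both lie in $G_iG_{-i}$. *)
Lemma nearly_eps_prodspan (A : Ring) (G : Z -> A -> Prop) i : grading G ->
  nearly_eps_strongly G -> s_unital_ideal (prodspan (G i) (G (- i)%Z)).
Proof.
move=> gG eps x hx.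
case: (prodspan_fix_left hx) => L [/(nearly_eps_left gG eps) [a [ha fa]] fL].
case: (prodspan_fix_right hx) => M [/(nearly_eps_right gG eps) [b [hb fb]] fM].
rewrite Z.opp_involutive in hb.
by exists a, b; rewrite fL ?fM.
Qed.

Lemma ringhom_factor (A B C : Ring) (f : A -> B) (g : A -> C) :
  ringhom f -> (forall y, exists x, f x = y) -> ringhom g ->
  (forall x, f x = 0 -> g x = 0) ->
  exists h : B -> C, ringhom h /\ forall x, h (f x) = g x.
Proof.
move=> [fD fM] f_surj [gD gM] ker.
pose pre y := proj1_sig (constructive_indefinite_description _ (f_surj y)).
have preE y : f (pre y) = y by rewrite /pre; case: constructive_indefinite_description.
have hE x : g (pre (f x)) = g x.
  apply/rsub_eq0; rewrite -(additiveB gD); apply: ker.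
  by rewrite (additiveB fD) preE raddrN.
exists (fun y => g (pre y)); split=> //; split=> x y.
  by rewrite -gD -{1}(preE x) -{1}(preE y) -fD hE.
by rewrite -gM -{1}(preE x) -{1}(preE y) -fM hE.
Qed.

(** * The system of components of degrees 0, -1 and 1 *)

Section DegreeSystem.
Variables (A : Ring) (G : Z -> A -> Prop).
Hypothesis gG : grading G.

Definition deg_ring : Ring :=
  @sub_ring A (G 0) (proj1 gG 0%Z) (fun x y => proj2 gG 0%Z 0%Z x y).

Lemma grading_mulr0 d x y : G d x -> G 0 y -> G d (x * y).
Proof. by move=> hx hy; rewrite -(Z.add_0_r d); apply: (proj2 gG). Qed.

Definition deg_bimod (d : Z) : Bimod deg_ring.
refine (@Build_Bimod deg_ring {x | G d x} (exist _ 0 (proj1 (proj1 gG d)))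
  (fun x y => exist _ (proj1_sig x + proj1_sig y)
     (proj1 (proj2 (proj1 gG d)) _ _ (proj2_sig x) (proj2_sig y)))
  (fun x => exist _ (- proj1_sig x) (proj2 (proj2 (proj1 gG d)) _ (proj2_sig x)))
  (fun (r : {x | G 0 x}) x => exist _ (proj1_sig r * proj1_sig x)
     (proj2 gG 0%Z d _ _ (proj2_sig r) (proj2_sig x)))
  (fun x (r : {x | G 0 x}) => exist _ (proj1_sig x * proj1_sig r)
     (grading_mulr0 (proj2_sig x) (proj2_sig r)))
  _ _ _ _ _ _ _ _ _ _ _); move=> *; apply: sub_val_inj => /=.
- exact: raddA.
- exact: raddC.
- exact: radd0.
- exact: raddN.
- exact: rmulDl.
- exact: rmulDr.
- exact: rmulDl.
- exact: rmulDr.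
- by rewrite rmulA.
- exact: rmulA.
- by rewrite rmulA.
Defined.

Definition deg_system : System deg_ring.
refine (@Build_System deg_ring (deg_bimod (-1)) (deg_bimod 1)
  (fun (p : {x | G (-1)%Z x}) (q : {x | G 1%Z x}) => exist _ (proj1_sig p * proj1_sig q)
     (proj2 gG (-1)%Z 1%Z _ _ (proj2_sig p) (proj2_sig q))) _ _ _ _ _);
  move=> *; apply: sub_val_inj => /=.
- exact: rmulDl.
- exact: rmulDr.
- by rewrite rmulA.
- by rewrite rmulA.
- exact: rmulA.
Defined.

Definition degR (r : deg_ring) : A := proj1_sig (r : {x | G 0 x}).
Definition degP (p : sP deg_system) : A := proj1_sig (p : {x | G (-1)%Z x}).
Definition degQ (q : sQ deg_system) : A := proj1_sig (q : {x | G 1%Z x}).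

Lemma degR_deg r : G 0 (degR r). Proof. exact: proj2_sig. Qed.
Lemma degP_deg p : G (-1)%Z (degP p). Proof. exact: proj2_sig. Qed.
Lemma degQ_deg q : G 1%Z (degQ q). Proof. exact: proj2_sig. Qed.

Lemma degR_ex x : G 0 x -> exists r, x = degR r.
Proof. by move=> h; exists (exist _ x h). Qed.
Lemma degP_ex x : G (-1)%Z x -> exists p, x = degP p.
Proof. by move=> h; exists (exist _ x h). Qed.
Lemma degQ_ex x : G 1%Z x -> exists q, x = degQ q.
Proof. by move=> h; exists (exist _ x h). Qed.

Lemma degR_inj r r' : degR r = degR r' -> r = r'. Proof. exact: sub_val_inj. Qed.
Lemma degP_inj p p' : degP p = degP p' -> p = p'. Proof. exact: sub_val_inj. Qed.
Lemma degQ_inj q q' : degQ q = degQ q' -> q = q'. Proof. exact: sub_val_inj. Qed.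

Lemma deg_covrep : covrep degP degQ degR.
Proof. by do !split. Qed.

Local Notation piA := (piSum degP degQ).

Lemma piSum_deg l : prodspan (G 1) (G (-1)%Z) (piA l).
Proof.
elim: l => [|t l IH] /=; first exact: span_zero.
apply: span_add => //; apply: prodspan_mul; [exact: degQ_deg | exact: degP_deg].
Qed.

Lemma prodspan_piSum x : prodspan (G 1) (G (-1)%Z) x -> exists l, x = piA l.
Proof.
elim=> {x} [_ [u [v [/degQ_ex [q ->] [/degP_ex [p ->] ->]]]]||x y _ [l ->] _ [l' ->]|x _ [l ->]].
- by exists [(q, p)]; rewrite /= raddr0.
- by exists [].
- by exists (l ++ l'); elim: l => [|t l IH] /=; rewrite ?radd0 // -IH raddA.
- exists (map (fun t => (mopp (fst t), snd t)) l).
  by elim: l => [|t l IH] /=; rewrite ?ropp0 // roppD IH /degQ /= rmulNr.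
Qed.

Hypothesis eps : nearly_eps_strongly G.

Lemma deg_condFS : condFS deg_system.
Proof.
move=> qs ps; split.
- have [x /in_map_iff [q [<- _]]|a [/prodspan_piSum [l ->] fa]] :=
    @nearly_eps_left A G gG eps 1%Z (map degQ qs); first exact: degQ_deg.
  exists (@thetaQ _ deg_system l); split; first by exists l.
  move=> q hq; apply: degQ_inj; rewrite (piSum_thetaQ _ _ deg_covrep).
  by apply: fa; apply: in_map.
- have [x /in_map_iff [q [<- _]]|a [/prodspan_piSum [l ->] fa]] :=
    @nearly_eps_right A G gG eps (-1)%Z (map degP ps); first exact: degP_deg.
  exists (@thetaP _ deg_system (map (fun t => (snd t, fst t)) l)); split.
    by exists (map (fun t => (snd t, fst t)) l).
  move=> p hp; apply: degP_inj; rewrite (piSum_thetaP _ _ deg_covrep).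
  by apply: fa; apply: in_map.
Qed.

Lemma deg_units i x : G i x -> exists a b, degR a * x = x /\ x * degR b = x.
Proof.
case/eps => a [b [ha [hb [ea eb]]]].
have [a' Ea] : exists a', a = degR a'.
  by apply: degR_ex; refine (prodspan_deg gG _ ha); lia.
have [b' Eb] : exists b', b = degR b'.
  by apply: degR_ex; refine (prodspan_deg gG _ hb); lia.
by exists a', b'; rewrite -Ea -Eb.
Qed.

Lemma deg_s_unital : s_unital_system deg_system.
Proof.
split; [|split].
- move=> r; case: (deg_units (degR_deg r)) => a [b [ea eb]].
  by exists a, b; split; apply: degR_inj.
- move=> p; case: (deg_units (degP_deg p)) => a [b [ea eb]].
  by exists a, b; split; apply: degP_inj.
- move=> q; case: (deg_units (degQ_deg q)) => a [b [ea eb]].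
  by exists a, b; split; apply: degQ_inj.
Qed.

Definition deg_ideal (r : deg_ring) : Prop := prodspan (G 1) (G (-1)%Z) (degR r).

(** [z] has a right local unit that is a sum of products [q p] with [q] in $G_1$, and [z] kills each
    such [q]. *)
Lemma prodspan_faithful z : prodspan (G 1) (G (-1)%Z) z ->
  (forall q, z * degQ q = 0) -> z = 0.
Proof.
move=> hz zQ; case: (nearly_eps_prodspan (i := 1%Z) gG eps hz) => _ [b [_ [hb [_ <-]]]].
by case: (prodspan_piSum hb) => l ->; apply: piSum_mulr.
Qed.

Lemma degQ_lact r q : degQ (lact r q) = degR r * degQ q.
Proof. by []. Qed.

Lemma Delta_thetaQ r l q : (forall q, Delta deg_system r q = thetaQ l q) ->
  degR r * degQ q = piA l * degQ q.
Proof.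
by move=> /(_ q) E; rewrite -(piSum_thetaQ _ _ deg_covrep) -E.
Qed.

Lemma deg_ideal_cf : compat_faithful deg_system deg_ideal.
Proof.
split; [|split].
- split; first exact: span_zero.
  split; first by move=> x y; exact: span_add.
  split; first by move=> x; exact: span_opp.
  by split=> r x; [apply: prodspan_mull | apply: prodspan_mulr] => //; exact: degR_deg.
- move=> r /prodspan_piSum [l E]; exists l => q; apply: degQ_inj.
  by rewrite (piSum_thetaQ _ _ deg_covrep) -E.
- move=> r hr r0; apply: degR_inj; apply: prodspan_faithful hr _ => q.
  by rewrite -degQ_lact; move: (r0 q); rewrite /Delta => ->.
Qed.

(** A generator of T(J) may use any list that induces [Delta r]; faithfulness shows that all of them
    have the same value in [A]. *)
Lemma deg_ideal_piSum r l : deg_ideal r ->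
  (forall q, Delta deg_system r q = thetaQ l q) -> degR r = piA l.
Proof.
move=> hr E; apply/rsub_eq0; apply: prodspan_faithful.
  by apply: span_add => //; apply: span_opp; exact: piSum_deg.
by move=> q; rewrite rmulDl rmulNr (Delta_thetaQ _ E) raddrN.
Qed.

Hypothesis ann : ann_condition G.

(** Let [y] in $G_1G_{-1}$ act on $G_1$ as [r] does. Then [r - y] annihilates $G_1$. For [s] in the
    annihilator, [r s] and [s r] lie in [J] and act as zero, so they vanish as [J] is faithful;
    [y s] and [s y] vanish too. So [r - y] is also in the perp of the annihilator, and [r = y]. *)
Lemma compat_faithful_sub J r : compat_faithful deg_system J -> J r -> deg_ideal r.
Proof.
move=> [[J0 [JD [JN [Jl Jr]]]] [Jc Jf]] hr.
case: (Jc r hr) => l E.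
have G0 := proj1 gG 0%Z; case: (G0) => _ [GD GN].
have hy := piSum_deg l.
have hy0 : G 0 (piA l) by exact: (prodspan_deg gG _ hy).
suff e : degR r = piA l by rewrite /deg_ideal e.
apply/rsub_eq0; apply: ann.
- split; first by apply: (GD) (GN _ hy0); exact: degR_deg.
  move=> _ /degQ_ex [q ->].
  by rewrite rmulDl rmulNr (Delta_thetaQ _ E) raddrN.
- split; first by apply: (GD) (GN _ hy0); exact: degR_deg.
  move=> _ [/degR_ex [s ->] sA].
  have sQ q : degR s * degQ q = 0 by apply: sA; exact: degQ_deg.
  have rs0 : degR r * degR s = 0.
    have -> : degR r * degR s = degR (r * s) by [].
    rewrite (Jf (r * s)) //; first exact: Jr.
    move=> q; apply: degQ_inj; rewrite /Delta degQ_lact.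
    have -> : degR (r * s) = degR r * degR s by [].
    by rewrite -rmulA sQ rmulr0.
  have sr0 : degR s * degR r = 0.
    have -> : degR s * degR r = degR (s * r) by [].
    rewrite (Jf (s * r)) //; first exact: Jl.
    move=> q; apply: degQ_inj; rewrite /Delta degQ_lact.
    have -> : degR (s * r) = degR s * degR r by [].
    by rewrite -rmulA -degQ_lact sQ.
  have ys0 : piA l * degR s = 0.
    apply: prodspan_faithful; first by apply: prodspan_mulr => //; exact: degR_deg.
    by move=> q; rewrite -rmulA sQ rmulr0.
  have sy0 : degR s * piA l = 0 by exact: piSum_mulr.
  by rewrite rmulDl rmulDr rmulNr rmulrN rs0 sr0 ys0 sy0 raddrN.
Qed.

Lemma deg_ideal_max : maximal_cf deg_system deg_ideal.
Proof.
split; first exact: deg_ideal_cf.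
by move=> J hJ _ x; exact: compat_faithful_sub.
Qed.

Lemma deg_CP_welldef : CP_welldef deg_system.
Proof.
exists deg_ideal; split; first exact: deg_ideal_max.
move=> J [hJ maxJ] x; split; first exact: compat_faithful_sub.
apply: maxJ; first exact: deg_ideal_cf.
by move=> y; exact: compat_faithful_sub.
Qed.
End DegreeSystem.

(** * Representations in which every product [V q * U p] is a coefficient *)

Section CuntzKrieger.
Variables (R : Ring) (sy : System R) (C : Ring).
Variables (U : sP sy -> C) (V : sQ sy -> C) (sg : R -> C).
Hypotheses (cr : covrep U V sg) (su : s_unital_system sy).
Hypothesis VU : forall q p, exists r, V q * U p = sg r.

(** Since [VU] also removes a [V] standing before a [U], no mixed words remain; by truncation one of
    the two counts is zero. *)
Lemma Tgrad_NF_CK d x : Tgrad U V sg d x ->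
  span (NF U V sg (Z.to_nat d) (Z.to_nat (- d))) x.
Proof.
move: d x; apply: Tgrad_least => [d|[r|p|q]|g d].
- exact: subgroup_span.
- by apply: span_in; constructor.
- rewrite /=; case: (U_unit cr su p) => r [_ [-> _]].
  by apply: span_in; apply: (@NF_P _ _ _ U V sg 0 0); constructor.
- rewrite /=; case: (V_unit cr su q) => _ [r [_ ->]].
  by apply: span_in; apply: (@NF_Q _ _ _ U V sg 0 0); constructor.
- apply: span_map; first exact: mul_l_additive.
  move=> x h; apply: span_in; case: g => [r|p|q]; first exact: NF_lact.
  + rewrite /gdeg; case: (Z.le_gt_cases d 0) => hd.
      have -> : Z.to_nat (-1 + d) = 0%nat by lia.
      have -> : Z.to_nat (- (-1 + d)) = S (Z.to_nat (- d)) by lia.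
      move: h; have -> : Z.to_nat d = 0%nat by lia.
      exact: NF_P_cons.
    have -> : Z.to_nat (- (-1 + d)) = 0%nat by lia.
    move: h; have -> : Z.to_nat d = S (Z.to_nat (-1 + d)) by lia.
    have -> : Z.to_nat (- d) = 0%nat by lia.
    exact: NF_P_mul.
  + rewrite /gdeg; case: (Z.le_gt_cases 0 d) => hd.
      have -> : Z.to_nat (1 + d) = S (Z.to_nat d) by lia.
      have -> : Z.to_nat (- (1 + d)) = 0%nat by lia.
      move: h; have -> : Z.to_nat (- d) = 0%nat by lia.
      exact: NF_Q.
    have -> : Z.to_nat (1 + d) = 0%nat by lia.
    move: h; have -> : Z.to_nat d = 0%nat by lia.
    have -> : Z.to_nat (- d) = S (Z.to_nat (- (1 + d))) by lia.
    (* A [V] meets a word of negative degree: it cancels against the first [U]. *)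
    case/(NF_SP_inv_left cr su) => p [y [hy ->]].
    by rewrite /gval rmulA; case: (VU q p) => r ->; apply: NF_lact.
Qed.

(** In the absence of mixed words, $O_{-k}O_k$ is spanned by products of a pure [U] word with a pure
    [V] word of the same length, and these are values of [psik]. *)
Lemma CK_semi_full : semi_full sy sg (Tgrad U V sg).
Proof.
have gT := Tgrad_grading U V sg.
move=> k x; split.
- apply: span_least.
    by split; [exact: ig_zero | split; [exact: ig_add | exact: ig_opp]].
  have sI : subgroup (Ik sy sg (Tgrad U V sg) k).
    by split; [exact: ig_zero | split; [exact: ig_add | exact: ig_opp]].
  move=> _ [y [z [/Tgrad_NF_CK hy [/Tgrad_NF_CK hz ->]]]].
  move: hy hz.
  have -> : Z.to_nat (- Z.of_nat k) = 0%nat by lia.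
  rewrite Z.opp_involutive Nat2Z.id; apply: span_mul_least => // {}y {}z hy hz.
  case: k {sI} hy hz => [|k] hy hz; apply: ig_in.
    case: (NF00_inv hy) (NF00_inv hz) => r -> [s ->]; exists r, s.
    by case: cr => _ [_ [[_ ->]]].
  case: (NF_psik cr su hy hz) => p [q [ps [qs [lps [lqs ->]]]]].
  by exists p, q, ps, qs.
- elim=> {x} [x hx||x y _ hx _ hy|x _ hx|b x hb _ hx|b x hb _ hx].
  + case: k hx => [[r [s ->]]|k [p [q [ps [qs [lps [lqs ->]]]]]]].
      case: (cr) => _ [_ [[_ ->] _]].
      by apply: prodspan_mul; apply: Tgrad_R.
    by rewrite -lps; apply: (psik_prodspan cr); rewrite lps lqs.
  + exact: span_zero.
  + exact: span_add.
  + exact: span_opp.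
  + exact: (prodspan_mull gT hb).
  + exact: (prodspan_mulr gT hb).
Qed.
End CuntzKrieger.

(** Turns a unit for finitely many elements of [Q] into a unit for [x]; this is how local units are
    lifted along a map out of [C]. *)
Lemma span_NF_fix_left (R : Ring) (sy : System R) (C : Ring)
    (U : sP sy -> C) (V : sQ sy -> C) (sg : R -> C) m n x :
  covrep U V sg -> span (NF U V sg (S m) n) x ->
  exists L : list (sQ sy), forall a, (forall q, In q L -> lact a q = q) -> sg a * x = x.
Proof.
move=> [_ [_ [_ [_ [_ [_ [Vl _]]]]]]].
elim=> {x} [x /NF_SQ_inv [q [y [_ ->]]]||x y _ [L fL] _ [M fM]|x _ [L fL]].
- by exists [q] => a fa; rewrite rmulA -Vl fa //; left.
- by exists [] => a _; rewrite rmulr0.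
- exists (L ++ M) => a fa.
  by rewrite rmulDr fL ?fM // => q hq; apply: fa; apply/in_app_iff; tauto.
- by exists L => a fa; rewrite rmulrN fL.
Qed.

Lemma span_NF_fix_right (R : Ring) (sy : System R) (C : Ring)
    (U : sP sy -> C) (V : sQ sy -> C) (sg : R -> C) m n x :
  covrep U V sg -> span (NF U V sg m (S n)) x ->
  exists L : list (sP sy), forall a, (forall p, In p L -> ract p a = p) -> x * sg a = x.
Proof.
move=> cr hx.
have hx' : @span (opp_ring C) (@NF _ (opp_system sy) (opp_ring C) V U sg (S n) m) x.
  move: x hx; apply: span_least => [|x /NF_opp hx]; last exact: span_in.
  exact: (subgroup_span (A := opp_ring C)).
exact: (span_NF_fix_left (opp_covrep cr) hx').
Qed.

(** * A graded ring as the Cuntz-Pimsner ring of its components of degree 0, -1 and 1 *)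

Section Representation.
Variables (A : Ring) (G : Z -> A -> Prop).
Hypotheses (gG : grading G) (eps : nearly_eps_strongly G) (ann : ann_condition G).
Hypothesis G_gen : forall x, span (fun y => exists i, G i y) x.
(** Generation by degrees -1, 0 and 1, phrased as an induction principle. *)
Hypothesis G_min : forall H : Z -> A -> Prop, (forall i, subgroup (H i)) ->
  (forall i x, (-1 <= i <= 1)%Z -> G i x -> H i x) ->
  (forall i j x y, H i x -> H j y -> H (i + j)%Z (x * y)) ->
  forall i x, G i x -> H i x.
Hypothesis G_ind : forall N f, (forall i, G i (f i)) -> symsum N f = 0 ->
  forall i, (Z.abs i <= Z.of_nat N)%Z -> f i = 0.

Local Notation sy0 := (deg_system gG).
Local Notation degR := (degR (gG := gG)).
Local Notation degP := (degP (gG := gG)).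
Local Notation degQ := (degQ (gG := gG)).
Local Notation piA := (piSum degP degQ).

Lemma Tgrad_deg : Tgrad degP degQ degR = G.
Proof.
apply: functional_extensionality => i; apply: functional_extensionality => x.
apply: propositional_extensionality; split.
- move: i x; apply: Tgrad_least => [i|g|g i x hx].
  + exact: (proj1 gG).
  + case: g => [r|p|q]; [exact: degR_deg | exact: degP_deg | exact: degQ_deg].
  + apply: (proj2 gG) hx.
    case: g => [r|p|q]; [exact: degR_deg | exact: degP_deg | exact: degQ_deg].
- apply: G_min => {i x} [i|i x hi|i j x y].
  + exact: subgroup_span.
  + have [->|[->|->]] : (i = -1 \/ i = 0 \/ i = 1)%Z by lia.
    * by move/(degP_ex gG) => [p ->]; exact: Tgrad_P.
    * by move/(degR_ex gG) => [r ->]; exact: Tgrad_R.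
    * by move/(degQ_ex gG) => [q ->]; exact: Tgrad_Q.
  + exact: Tgrad_mul.
Qed.

Section Injectivity.
Variables (C : Ring) (U : sP sy0 -> C) (V : sQ sy0 -> C) (sg : deg_ring gG -> C).
Variable f : C -> A.
Hypotheses (cr : covrep U V sg) (hf : ringhom f).
Hypotheses (fU : forall p, f (U p) = degP p) (fV : forall q, f (V q) = degQ q)
  (fsg : forall r, f (sg r) = degR r).
Hypothesis CK : forall r l, degR r = piA l -> sg r = piSum U V l.

Let VU q p : exists r, V q * U p = sg r.
Proof.
have [r E] : exists r, degQ q * degP p = degR r.
  apply: degR_ex; exact: (proj2 gG 1%Z (-1)%Z _ _ (degQ_deg q) (degP_deg p)).
exists r; rewrite -(raddr0 (V q * U p)); symmetry; apply: (@CK r [(q, p)]).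
by rewrite /= raddr0 E.
Qed.

Let su : s_unital_system sy0.
Proof. exact: deg_s_unital. Qed.

(** In degree 0 every element is a single [sg r], on which [f] is injective. In degree [k + 1],
    [c = sg r * c] for a lifted local unit, and [CK] rewrites [sg r] as a sum of [V q * U p]. Each
    [U p * c] has degree [k] and is killed by [f]. *)
Lemma inj_pos k c : Tgrad U V sg (Z.of_nat k) c -> f c = 0 -> c = 0.
Proof.
elim: k c => [|k IH] c hc fc0.
  have [r E] : exists r, c = sg r.
    case: cr => _ [_ [[sD _] _]].
    move: (Tgrad_NF_CK cr su VU hc) => {fc0} h; move: c h {hc}.
    apply: span_least => [|x /NF00_inv //].
    split; first by exists 0; rewrite (additive0 sD).
    split=> [_ _ [r ->] [s ->]|_ [r ->]]; first by exists (r + s); rewrite sD.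
    by exists (- r); rewrite (additiveN sD).
  case: cr => _ [_ [[sD _] _]].
  move: fc0; rewrite E fsg => r0.
  by have -> : r = 0 by [exact: degR_inj]; rewrite (additive0 sD).
move: (Tgrad_NF_CK cr su VU hc); rewrite Nat2Z.id.
case/(span_NF_fix_left cr) => L fL.
have [x /in_map_iff [q [<- _]]|a [ha fa]] :=
  @nearly_eps_left A G gG eps 1%Z (map degQ L); first exact: degQ_deg.
case: (prodspan_piSum gG ha) => l El.
have [r Er] : exists r, a = degR r by apply: degR_ex; refine (prodspan_deg gG _ ha).
(* [a] fixes the leading factors as elements of [A], hence [r] fixes them in the module, as [degQ]
   is injective. *)
have <- : sg r * c = c.
  apply: fL => q hq; apply: degQ_inj; rewrite degQ_lact -Er.
  by apply: fa; apply: in_map.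
rewrite (CK (l := l)); first by rewrite -Er.
apply: piSum_mull => p; apply: IH; last by rewrite (proj2 hf) fc0 rmulr0.
have := Tgrad_mul (Tgrad_P U V sg p) hc; congr (Tgrad _ _ _ _ _); lia.
Qed.

(** Right units in degree -1 lie in $G_1G_{-1}$ as well, so the same relation [CK] serves. *)
Lemma inj_neg k c : Tgrad U V sg (- Z.of_nat k) c -> f c = 0 -> c = 0.
Proof.
elim: k c => [|k IH] c hc fc0; first exact: (@inj_pos 0).
move: (Tgrad_NF_CK cr su VU hc); rewrite Z.opp_involutive Nat2Z.id.
case/(span_NF_fix_right cr) => L fL.
have [x /in_map_iff [q [<- _]]|a [ha fa]] :=
  @nearly_eps_right A G gG eps (-1)%Z (map degP L); first exact: degP_deg.
case: (prodspan_piSum gG ha) => l El.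
have [r Er] : exists r, a = degR r by apply: degR_ex; refine (prodspan_deg gG _ ha).
have <- : c * sg r = c.
  apply: fL => p hp; apply: degP_inj.
  by rewrite -[RHS]fa ?Er //; apply: in_map.
rewrite (CK (l := l)); first by rewrite -Er.
apply: piSum_mulr => q; apply: IH; last by rewrite (proj2 hf) fc0 rmul0r.
have := Tgrad_mul hc (Tgrad_Q U V sg q); congr (Tgrad _ _ _ _ _); lia.
Qed.

Lemma inj_all c : span (fun y => exists i, Tgrad U V sg i y) c -> f c = 0 -> c = 0.
Proof.
move=> /(span_symsum (fun i => subgroup_span _)) [N [g [hg ->]]] f0.
have fG i : G i (f (g i)).
  have E : Ograd U V sg f = G.
    rewrite (Ograd_comp _ _ _ hf); apply: eq_trans Tgrad_deg.
    by congr Tgrad; apply: functional_extensionality.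
  have : Ograd U V sg f i (f (g i)) by exists (g i); split=> //; exact: hg.
  by rewrite E.
have g0 i : (Z.abs i <= Z.of_nat N)%Z -> g i = 0.
  move=> hi.
  have fg0 : f (g i) = 0.
    by apply: (G_ind (f := fun i => f (g i))) hi => //; rewrite -(symsum_morph _ _ (proj1 hf)).
  case: (Z.le_ge_cases 0 i) => le0i.
    by apply: (@inj_pos (Z.to_nat i)); rewrite // Z2Nat.id.
  apply: (@inj_neg (Z.to_nat (- i))) => //.
  by have -> : (- Z.of_nat (Z.to_nat (- i)))%Z = i by lia.
elim: N g0 {f0} => [|N IH] g0; first exact: g0.
rewrite symsumS IH; first by move=> i hi; apply: g0; lia.
by rewrite !g0 ?radd0 //; lia.
Qed.
End Injectivity.

(** [A] itself serves as the Cuntz-Pimsner ring, with [eta] as quotient map. The work is to show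
    that the kernel of [eta] is T(J). *)
Theorem graded_CP_ring : exists (B : Ring) (U : sP sy0 -> B) (V : sQ sy0 -> B)
    (sg : deg_ring gG -> B) (eta : B -> A),
  is_CP_ring U V sg eta /\ Ograd U V sg eta = G /\
  semi_full sy0 (fun r => eta (sg r)) G.
Proof.
have [B [U [V [sg tp]]]] := toeplitz_exists sy0.
have [cr univ] := tp.
have [[eta [heta [etaU [etaV etas]]]] _] := univ _ _ _ _ (deg_covrep gG).
have [eD eM] := heta.
have etaE : (fun p => eta (U p)) = degP /\ (fun q => eta (V q)) = degQ /\
    (fun r => eta (sg r)) = degR.
  by do !split; apply: functional_extensionality.
have [EP [EQ ER]] := etaE.
have OG : Ograd U V sg eta = G by rewrite (Ograd_comp _ _ _ heta) EP EQ ER Tgrad_deg.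
exists B, U, V, sg, eta; split; last first.
  split=> //; rewrite ER.
  have : semi_full sy0 degR (Tgrad degP degQ degR).
    apply: CK_semi_full; [exact: deg_covrep | exact: deg_s_unital |].
    move=> q p; apply: degR_ex.
    exact: (proj2 gG 1%Z (-1)%Z _ _ (degQ_deg q) (degP_deg p)).
  by rewrite Tgrad_deg.
split; first exact: deg_CP_welldef.
split=> //; exists (deg_ideal (gG := gG)); split; first exact: deg_ideal_max.
split=> //; split.
  move=> y; move: y (G_gen y); apply: span_least.
    split; first by exists 0; rewrite (additive0 eD).
    split=> [_ _ [x <-] [y <-]|_ [x <-]]; first by exists (x + y); rewrite eD.
    by exists (- x); rewrite (additiveN eD).
  by move=> y [i]; rewrite -OG => -[x [_ ->]]; exists x.
have eta_TJ x : TJ U V sg (deg_ideal (gG := gG)) x -> eta x = 0.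
{ elim=> {x} [_ [r [l [hr [E ->]]]]||x y _ hx _ hy|x _ hx|b x _ _ hx|b x _ _ hx].
  - rewrite (additiveB eD) etas (ringhom_piSum _ _ _ heta) EP EQ.
    by rewrite (deg_ideal_piSum eps hr E) raddrN.
  - exact: additive0.
  - by rewrite eD hx hy radd0.
  - by rewrite (additiveN eD) hx ropp0.
  - by rewrite eM hx rmulr0.
  - by rewrite eM hx rmul0r. }
move=> x; split=> [ex0|]; last exact: eta_TJ.
have idTJ : is_ideal (TJ U V sg (deg_ideal (gG := gG))).
  split; first exact: ig_zero.
  split; first exact: ig_add.
  split; first exact: ig_opp.
  by split=> *; [apply: ig_mull | apply: ig_mulr].
(* [eta] factors through this quotient as [f]; injectivity of [f] puts the kernel of [eta] inside
   T(J). *)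
have [C [rho [hrho [rho_surj rho_ker]]]] := ideal_quotient idTJ.
have [rD _] := hrho.
have rho_eta b : rho b = 0 -> eta b = 0 by move/rho_ker/eta_TJ.
have [f [hf fE]] := ringhom_factor hrho rho_surj heta rho_eta.
apply/rho_ker; apply: (inj_all (covrep_comp hrho cr) hf).
- by move=> p; rewrite fE.
- by move=> q; rewrite fE.
- by move=> r; rewrite fE.
(* [CK] holds in the quotient because [sg r - piSum U V l] is one of the generators of T(J). *)
- move=> r l E; rewrite -(ringhom_piSum _ _ _ hrho).
  apply/rsub_eq0; rewrite -(additiveB rD); apply/rho_ker; apply: ig_in.
  exists r, l; split; first by rewrite /deg_ideal E; exact: piSum_deg.
  split=> // q; apply: degQ_inj.
  by rewrite (piSum_thetaQ _ _ (deg_covrep gG)) -E.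
- move: {ex0} x (toeplitz_span x tp); apply: span_map => // y [i hy].
  apply: span_in; exists i; rewrite -(Ograd_comp _ _ _ hrho); by exists y.
- by rewrite fE.
Qed.
End Representation.

Theorem mainTheorem1 :
  (forall (R : Ring) (sy : System R), condFS sy -> CP_welldef sy ->
   forall (B O : Ring) (S : sP sy -> B) (T : sQ sy -> B) (sg : R -> B) (rho : B -> O),
   is_CP_ring S T sg rho ->
   nearly_eps_strongly (Ograd S T sg rho) ->
   ann_condition (Ograd S T sg rho) ->
   exists (R' : Ring) (sy' : System R'), condFS sy' /\ CP_welldef sy' /\
   exists (B' O' : Ring) (S' : sP sy' -> B') (T' : sQ sy' -> B') (sg' : R' -> B') (rho' : B' -> O'),
     is_CP_ring S' T' sg' rho' /\
     graded_iso (Ograd S T sg rho) (Ograd S' T' sg' rho') /\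
     (* (a) *) s_unital_system sy' /\
     (* (b) *) semi_full sy' (fun r => rho' (sg' r)) (Ograd S' T' sg' rho') /\
     (* (c) *) condFS sy' /\
     (* (d) *) (forall k : nat, s_unital_ideal (Ik sy' (fun r => rho' (sg' r)) (Ograd S' T' sg' rho') k)))
  /\
  (forall (R' : Ring) (sy' : System R'), condFS sy' -> CP_welldef sy' ->
   forall (B' O' : Ring) (S' : sP sy' -> B') (T' : sQ sy' -> B') (sg' : R' -> B') (rho' : B' -> O'),
   is_CP_ring S' T' sg' rho' ->
   s_unital_system sy' ->
   semi_full sy' (fun r => rho' (sg' r)) (Ograd S' T' sg' rho') ->
   condFS sy' ->
   (forall k : nat, s_unital_ideal (Ik sy' (fun r => rho' (sg' r)) (Ograd S' T' sg' rho') k)) ->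
   nearly_eps_strongly (Ograd S' T' sg' rho')).
Proof.
split.
- move=> R sy _ _ B O U V sg rho hCP eps ann.
  have := hCP => -[_ [tp [_ [_ [hrho [rho_surj _]]]]]].
  have := tp => -[cr _].
  have OG := Ograd_comp U V sg hrho.
  have gG : grading (Ograd U V sg rho) by rewrite OG; exact: Tgrad_grading.
  have [|||B' [U' [V' [sg' [eta [hCP' [OE full]]]]]]] := graded_CP_ring gG eps ann.
  + move=> y; case: (rho_surj y) => x <-.
    move: x (toeplitz_span x tp); apply: span_map; first exact: (proj1 hrho).
    by move=> x [i hx]; apply: span_in; exists i, x.
  + move=> H sH H1 HM; rewrite OG in H1 *; apply: Tgrad_least => // [g|g i x hx].
      by apply: H1 (Tgrad_letter _ _ _ g); case: g => /=; lia.
    by apply: HM hx; apply: H1 (Tgrad_letter _ _ _ g); case: g => /=; lia.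
  + exact: CP_independent.
  + exists (deg_ring gG), (deg_system gG).
    split; first exact: deg_condFS.
    split; first exact: deg_CP_welldef.
    exists B', O, U', V', sg', eta; rewrite OE.
    (* The new ring is the given [O] with the same grading, so the identity is the isomorphism. *)
    split=> //; split; first by exists (fun x => x), (fun x => x).
    split; first exact: deg_s_unital.
    split=> //; split; first exact: deg_condFS.
    (* By (b) the ideal equals $O_{-k}O_k$; [nearly_eps_prodspan] applies in degree [-k]. *)
    move=> k x /full; rewrite -{2}(Z.opp_involutive (Z.of_nat k)).
    case/(nearly_eps_prodspan gG eps) => a [b]; rewrite Z.opp_involutive => -[ha [hb e]].
    by exists a, b; split; [apply/full | split; [apply/full |]].
- move=> R sy FS _ B O U V sg rho [_ [[cr _] [_ [_ [hrho _]]]]] su.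
  rewrite (Ograd_comp _ _ _ hrho) => full _ sI.
  exact: (covrep_nearly_eps (covrep_comp hrho cr)).
Qed.
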